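(* Assume the Hardy-Littlewood Conjecture. Let $\alpha$ be an integer with $\alpha\equiv 1\pmod 4$ and let $D=\pm 2^\sigma p_1\cdots p_r(q_1\cdots q_s)^2(l_1\cdots l_t)^3$ be as in the context. Assume that every odd prime factor of $D$ divides $\alpha$. (1) If $D\equiv 1\pmod 4$, then $\mathrm{dens}_D(2\alpha)=\frac12\left(1+(-1)^{r_3+r_5+t_3+t_5}\right)$ and $\mathrm{dens}_D(-2\alpha)=\frac12\left(1-(-1)^{r_3+r_5+t_3+t_5}\right)$. (2) If $D\equiv 3\pmod 4$, then $\mathrm{dens}_D(2\alpha)=\mathrm{dens}_D(-2\alpha)=\frac12$. (3) Assume $4\parallel D$. If $\frac D4\equiv 1\pmod 4$, then $\mathrm{dens}_D(2\alpha)=\mathrm{dens}_D(-2\alpha)=\frac12$. If $\frac D4\equiv 3\pmod 4$, then $\mathrm{dens}_D(2\alpha)=\frac12\left(1+(-1)^{r_3+r_5+t_3+t_5}\right)$ and $\mathrm{dens}_D(-2\alpha)=\frac12\left(1-(-1)^{r_3+r_5+t_3+t_5}\right)$. (4) If $2\parallel D$ or $8\parallel D$, then $\mathrm{dens}_D(2\alpha)=\mathrm{dens}_D(-2\alpha)=\frac14$.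
   Context: $D=\pm 2^\sigma p_1\cdots p_r(q_1\cdots q_s)^2(l_1\cdots l_t)^3$ with $\sigma\in\{0,1,2,3\}$, $r,s,t\ge0$, and the $p_i,q_i,l_i$ pairwise distinct odd primes. $r_i$ is the number of primes among $p_1,\dots,p_r$ congruent to $i$ mod $8$, and $t_i$ the number of primes among $l_1,\dots,l_t$ congruent to $i$ mod $8$. $2^k\parallel D$ means $2^k\mid D$ and $2^{k+1}\nmid D$. For a nonzero integer $D$, $E_D$ is the elliptic curve $y^2=x^3+Dx$, and for a prime $p\nmid 2D$, $a_p(E_D)=1+p-\#\tilde E_D(\mathbb{F}_p)$. For a nonzero integer $m$ put $Q(m,N)=\{p \text{ prime}: p=m^2+x^2\le N \text{ for some } x\in\mathbb{Z}\}$ and $$\mathrm{dens}_D(2m)=\lim_{N\to\infty}\frac{\#\{p\in Q(m,N): p\nmid 2D,\ a_p(E_D)=2m\}}{\#Q(m,N)}$$ (denoted $a_p(2m)$ in the paper); the claim includes that the limits exist. Hardy-Littlewood Conjecture: for all integers $a,b,c$ with $a>0$, $\gcd(a,b,c)=1$, $a+b$ and $c$ not both even, and $\Delta=b^2-4ac$ not a perfect square, the number $P(n)$ of primes less than $n$ of the form $ax^2+bx+c$ (with $x$ a nonnegative integer) satisfies $P(n)\sim\delta(a,b,c)\frac{\sqrt{n}}{\log n}$ as $n\to\infty$, where $$\delta(a,b,c)=\frac{\gcd(2,a+b)}{\sqrt{a}}\prod_{p\mid a,\ p\mid b,\ p>2}\frac{p}{p-1}\ \prod_{p\nmid a,\ p>2}\left(1-\frac{\left(\frac{\Delta}{p}\right)}{p-1}\right),$$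 the products being over primes (the second taken in increasing order of $p$) and $\left(\frac{\cdot}{p}\right)$ being the Legendre symbol. *)

(* Defs.v *)
From HB Require Import structures.
From mathcomp Require Import all_boot all_order all_algebra.
From mathcomp Require Import all_classical all_reals all_analysis.

Set Implicit Arguments.
Unset Strict Implicit.
Unset Printing Implicit Defensive.

Import Order.TTheory GRing.Theory Num.Theory.
Import numFieldNormedType.Exports.

Local Open Scope classical_set_scope.
Local Open Scope ring_scope.

(** Legendre symbol, for an odd prime [p] (['F_p] is only the field with [p]
    elements when [p] is prime). *)
Definition legendre (d : int) (p : nat) : int :=
  if (d%:~R : 'F_p) == 0 then 0
  else if [exists x : 'F_p, x ^+ 2 == d%:~R] then 1 else -1.

(** The infinite product is conditionally convergent: it is the limit of the
    products over the primes [p < n]. *)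
Definition HL_constant (R : realType) (a b c : int) : R :=
  let Delta := b ^+ 2 - 4 * a * c in
  (gcdz 2 (a + b))%:~R / Num.sqrt a%:~R
  * (\prod_(p <- primes `|a|%N | (p %| b)%Z && (2 < p)%N) (p%:R / (p%:R - 1)))
  * limn (fun n : nat =>
      \prod_(0 <= p < n | [&& prime p, ~~ (p %| a)%Z & (2 < p)%N])
        (1 - (legendre Delta p)%:~R / (p%:R - 1)) : R).

Definition quadratic_primes (a b c : int) (n : nat) : {set 'I_n} :=
  [set p : 'I_n | prime p &&
     `[< exists x : nat, (p : nat)%:Z = a * x%:Z ^+ 2 + b * x%:Z + c >]].

(** [f ~ g] is read as: the quotient [f / g] tends to 1. *)
Definition Hardy_Littlewood_conjecture (R : realType) : Prop :=
  forall a b c : int,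
    0 < a ->
    gcdz (gcdz a b) c = 1 ->
    ~ ((2 %| a + b)%Z /\ (2 %| c)%Z) ->
    (forall k : int, b ^+ 2 - 4 * a * c <> k ^+ 2) ->
    (fun n : nat => #|quadratic_primes a b c n|%:R
       / (HL_constant R a b c * (Num.sqrt n%:R / ln n%:R)) : R) @ \oo --> (1 : R).

(** Affine points over ['F_p] of the curve [y^2 = x^3 + D x]. *)
Definition E_affine_points (D : int) (p : nat) : {set 'F_p * 'F_p} :=
  [set P : 'F_p * 'F_p | P.2 ^+ 2 == P.1 ^+ 3 + D%:~R * P.1].

(** The summand [.+1] is the point at infinity. *)
Definition E_card (D : int) (p : nat) : nat := #|E_affine_points D p|.+1.

Definition a_p (D : int) (p : nat) : int := 1 + p%:Z - (E_card D p)%:Z.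

Definition Qset (m : int) (N : nat) : {set 'I_N.+1} :=
  [set p : 'I_N.+1 | prime p &&
     `[< exists x : int, (p : nat)%:Z = m ^+ 2 + x ^+ 2 >]].

Definition Qset_trace (D m : int) (N : nat) : {set 'I_N.+1} :=
  [set p in Qset m N | ~~ ((p : nat) %| 2 * D)%Z && (a_p D p == 2 * m)].

(** [dens_is D m d]: the limit defining [dens_D (2 m)] exists and is [d].  Note
    that the argument is [m], not [2 m]. *)
Definition dens_is (R : realType) (D m : int) (d : R) : Prop :=
  (fun N : nat => (#|Qset_trace D m N|)%:R / (#|Qset m N|)%:R : R) @ \oo --> d.

Definition exactly_divides (q k : nat) (D : int) : Prop :=
  ((q ^ k)%N %| D)%Z /\ ~ ((q ^ k.+1)%N %| D)%Z.

(** Number of members of [s] congruent to [i] modulo 8. *)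
Definition count_mod8 (i : nat) (s : seq nat) : nat :=
  count (fun p => p %% 8 == i)%N s.

(** [neg] is the sign of [D] (minus when [true]). *)
Definition D_factorization (D : int) (neg : bool) (sigma : nat)
    (ps qs ls : seq nat) : Prop :=
  [/\ (sigma <= 3)%N,
      uniq (ps ++ qs ++ ls),
      all (fun p => prime p && odd p) (ps ++ qs ++ ls) &
      D = (-1) ^+ neg * ((2 ^ sigma * (\prod_(p <- ps) p)
            * (\prod_(q <- qs) q) ^ 2 * (\prod_(l <- ls) l) ^ 3)%N)%:Z].

(* Main.v *)
Require Import Defs.
From HB Require Import structures.
From mathcomp Require Import all_boot all_order all_algebra.
From mathcomp Require Import all_solvable all_field.
From mathcomp Require Import all_classical all_reals all_analysis.
From mathcomp Require Import ring zify.

Set Implicit Arguments.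
Unset Strict Implicit.
Unset Printing Implicit Defensive.

Import Order.TTheory GRing.Theory Num.Theory.
Import numFieldNormedType.Exports.

Local Open Scope ring_scope.

(** Write [p = alpha^2 + 4 y^2].  Since the Hardy-Littlewood conjecture turns
    a congruence condition on [y] into a density, the theorem holds because the
    trace of Frobenius at [p], compared with [2 alpha], depends only on
    [y] modulo 4.

    The trace is minus the character sum [S(D) = sum_x eta(x^3 + D x)], which
    depends on [D] through its class modulo fourth powers:
    [S(c^2 D) = eta(c) S(D)] ([jacobsthal_scale]).  The second moment of [S]
    gives [S(-1)^2 + S(w)^2 = 4 p] for a nonresidue [w] ([jacobsthal_sqr_sum]),
    so that [S(-1)/2] and [S(w)/2] are [alpha] and [2 y] up to sign, and
    counting the orbits of the symmetries [x -> -x], [x -> 1/x] on the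
    curve [y^2 = x^3 - x] modulo 8 ([jacobsthal_neg1_mod8]) removes the sign:
    [S(-1) = -2 alpha (-1)^y] ([jacobsthal_neg1]).  So the trace is
    [2 alpha (-1)^y] times the quartic character of [-D] when [-D] is a square
    modulo [p], and [4 y] up to sign otherwise, which is never [2 alpha] up to
    sign.

    The quartic character of [-D] is computed factor by factor; its values at
    [-1] and at the square [4] are [(-1)^y].
    - An odd prime [l] dividing [alpha], with the sign that makes it 1 modulo
      4, has character 1 exactly when [l] is 1 or 7 modulo 8
      ([quartic_char_prime]).  This is the part of quartic reciprocity in which
      the Gaussian prime above [p] is purely imaginary modulo [l], and it has a
      short proof with Gauss sums over an algebraic closure of [F_l]: there
      [S(-1) = 0], which forces the quartic Gauss sum [G] to satisfy
      [G^4 = -p^2] ([quartic_gauss_expr4]), while the Frobenius gives [G^l].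
    - For [y = 2 z] the character of 2 is [(-1)^z] ([two_quartic]).  Following
      Dirichlet, [(alpha + 4 z)^2] is [8 alpha z] modulo [p], so it is enough
      to know the quadratic characters of [alpha] and of [alpha + 4 z]; these
      are found prime by prime from quadratic reciprocity.

    Hence the sign of the trace is constant when the exponent [sigma] of 2 in
    [D] is even and one sign condition on [D] holds, equals [(-1)^y] up to a
    constant when [sigma] is even and that condition fails, and for odd [sigma]
    the trace is [2 alpha] up to sign only when [y] is even, with sign
    [(-1)^(y/2)] up to a constant.  The Hardy-Littlewood constants of
    [4 x^2 + alpha^2], [16 x^2 + alpha^2] and [64 x^2 + alpha^2] are in the
    ratio 1 : 1/2 : 1/4 ([HL_constant_pow2]), because their discriminants
    differ by squares; and they do not vanish, since otherwise the quotient in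
    the conjecture would be identically 0 instead of tending to 1. *)

(** * Signs, congruences and sums of two squares *)

Lemma signr_eq (K : nzRingType) a b : (-1 : K) != 1 ->
  ((-1 : K) ^+ a == (-1) ^+ b) = (odd a == odd b).
Proof.
move=> N1; rewrite -[X in X == _]signr_odd -[X in _ == X]signr_odd.
by do 2![case: (odd _)]; rewrite ?eqxx //= ?(negPf N1) // eq_sym (negPf N1).
Qed.

(** With [z] a square root of [-1], the powers [z^k] and [(-1)^b = z^(2 b)] are
    compared through their exponents modulo 4.  This moves the value of a
    quartic character from one field to another. *)
Lemma expr_sqrtN1 (K : fieldType) (z : K) k b : (-1 : K) != 1 -> z ^+ 2 = -1 ->
  (z ^+ k == (-1) ^+ b) = (k == 2 * b %[mod 4])%N.
Proof.
move=> N1 z2; rewrite -{1}(odd_double_half k) -mul2n exprD exprM z2.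
case k_odd: (odd k); last first.
  by rewrite expr0 mul1r signr_eq //; move: k_odd; clear; lia.
transitivity false; last by move: k_odd; clear; lia.
apply/negP => /eqP /(congr1 (fun x => x ^+ 2)) /eqP.
by rewrite exprMn !sqrr_sign mulr1 z2 (negPf N1).
Qed.

Lemma odd_int_rep (z : int) : ~~ (2 %| z)%Z -> exists u, z = 2 * u + 1.
Proof. by move=> z_odd; exists (z %/ 2)%Z; lia. Qed.

Lemma eq1_mod4_rep (u : int) : (u = 1 %[mod 4])%Z -> exists k, u = 1 + 4 * k.
Proof. by move=> u1; exists ((u - 1) %/ 4)%Z; lia. Qed.

Lemma eq1_mod4_odd (u : int) : (u = 1 %[mod 4])%Z -> ~~ (2 %| u)%Z.
Proof. lia. Qed.

Lemma Fp_nat_eq0 p m : prime p -> ((m%:R : 'F_p) == 0) = (p %| m)%N.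
Proof. by move=> p_pr; rewrite -(dvdn_pcharf (pchar_Fp p_pr)). Qed.

Lemma Fp_prime_neq0 p l : prime p -> prime l -> l != p -> (l%:R : 'F_p) != 0.
Proof. by move=> p_pr l_pr neq_lp; rewrite Fp_nat_eq0 // dvdn_prime2 // eq_sym. Qed.

(** [p] divides [(a d)^2 - (b c)^2], hence, up to the sign of [b], it divides
    [a d - b c]; then the identity of Brahmagupta leaves only [a d = b c] or
    [a c + b d = 0], and the second possibility would make [p = a^2 + c^2]
    even. *)
Lemma prime_two_squares_odd (p : nat) (a b c d : int) : prime p -> odd p ->
    p%:Z = a ^+ 2 + b ^+ 2 -> p%:Z = c ^+ 2 + d ^+ 2 ->
    ~~ (2 %| a)%Z -> ~~ (2 %| c)%Z -> a ^+ 2 = c ^+ 2.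
Proof.
move=> p_pr p_odd def_ab def_cd a_odd c_odd.
have p_gt0 : 0 < p%:Z by rewrite ltz_nat prime_gt0.
wlog dvd_p : b def_ab / (p %| a * d - b * c)%Z => [IH|].
  have /orP[|] : (p%:Z %| a * d - b * c)%Z || (p%:Z %| a * d + b * c)%Z.
  - rewrite !dvdzE -Euclid_dvdM // -abszM -dvdzE; apply/dvdzP; exists (a ^+ 2 - c ^+ 2).
    rewrite [LHS](_ : _ = a ^+ 2 * d ^+ 2 - b ^+ 2 * c ^+ 2); last by ring.
    have -> : d ^+ 2 = p%:Z - c ^+ 2 by rewrite def_cd; ring.
    have -> : b ^+ 2 = p%:Z - a ^+ 2 by rewrite def_ab; ring.
    ring.
  - exact: IH.
  by move=> dv; apply: (IH (- b)); rewrite ?sqrrN // mulNr opprK.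
have /dvdzP[k def_k] := dvd_p.
have sq : (a * c + b * d) ^+ 2 + k ^+ 2 * p%:Z ^+ 2 = p%:Z ^+ 2.
  have : (a * c + b * d) ^+ 2 + (a * d - b * c) ^+ 2 = (a ^+ 2 + b ^+ 2) * (c ^+ 2 + d ^+ 2).
    by ring.
  by rewrite -def_ab -def_cd def_k exprMn -expr2.
have [k0|k0] := eqVneq k 0.
  have ad : a * d = b * c by apply/eqP; rewrite -subr_eq0 def_k k0 mul0r.
  apply: (mulfI (lt0r_neq0 p_gt0)).
  transitivity ((a * c) ^+ 2 + (a * d) ^+ 2); first by rewrite def_cd; ring.
  by rewrite ad def_ab; ring.
have e : a * c + b * d = 0.
  have k2 : 1 <= k ^+ 2 by rewrite -gtz0_ge1 exprn_even_gt0.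
  have : k ^+ 2 * p%:Z ^+ 2 >= p%:Z ^+ 2 by rewrite ler_peMl ?sqr_ge0.
  rewrite -{1}sq gerDr => le0; apply/eqP; rewrite -sqrf_eq0.
  by rewrite eq_le le0 sqr_ge0.
have e2 : (a * c) ^+ 2 = (b * d) ^+ 2 by apply/eqP; rewrite eqf_sqr -addr_eq0 e eqxx orbT.
have : p%:Z * (p%:Z - (a ^+ 2 + c ^+ 2)) = 0.
  transitivity ((p%:Z - a ^+ 2) * (p%:Z - c ^+ 2) - (a * c) ^+ 2); first by ring.
  by rewrite e2 {1}def_ab def_cd; ring.
have [u ->] := odd_int_rep a_odd; have [v ->] := odd_int_rep c_odd.
move/eqP; rewrite mulf_eq0 gt_eqF //= => /eqP; move: p_odd; clear.
rewrite (_ : _ + _ = 2 * (2 * u ^+ 2 + 2 * u + 2 * v ^+ 2 + 2 * v + 1)); last by ring.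
by move: (_ + 1) => t; lia.
Qed.

Lemma small_sqr_ndvd (p : nat) (c : int) :
  (2 < p)%N -> c != 0 -> c ^+ 2 <= 2 * p%:Z -> ~~ (p %| c)%Z.
Proof.
rewrite -ltz_nat => p_gt2 c0 le_c; apply/negP => /dvdzP[k def_c].
have k0 : k != 0 by apply: contra_neq c0 => k0; rewrite def_c k0 mul0r.
have k2 : 1 <= k ^+ 2 by rewrite -gtz0_ge1 exprn_even_gt0.
have p2 : p%:Z ^+ 2 <= 2 * p%:Z.
  by apply: le_trans le_c; rewrite def_c exprMn ler_peMl ?sqr_ge0.
by move: p2; rewrite expr2 ler_pM2r ?leNgt ?p_gt2 // (lt_trans _ p_gt2).
Qed.

(** * Characters of a finite field given by a primitive root *)

Lemma finField_expr1 (F : finFieldType) (t : F) : t != 0 -> t ^+ #|F|.-1 = 1.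
Proof.
move=> t0; apply: (mulfI t0).
by rewrite -exprS mulr1 (ltn_predK (finNzRing_gt1 F)) expf_card.
Qed.

(** All characters below are powers of the discrete logarithm to the base of
    such a root. *)
Lemma finField_prim_root (F : finFieldType) :
  {w : F | (#|F|.-1).-primitive_root w}.
Proof.
apply/sigW; pose rs := enum [pred x : F | x != 0].
have size_rs : size rs = #|F|.-1 by rewrite -cardE cardC1.
have [||||w _ w_prim] := @hasP _ _ rs (@has_prim_root F #|F|.-1 rs _ _ _ _).
- by have := finNzRing_gt1 F; case: #|F| => [|[]].
- apply/allP => x; rewrite mem_enum inE => x0; apply/unity_rootP.
  exact: finField_expr1.
- exact: enum_uniq.
- by rewrite size_rs.
by exists w.
Qed.

Section PowerCharacters.

Variables (F : finFieldType) (w : F).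
Hypothesis w_prim : (#|F|.-1).-primitive_root w.

Let n := #|F|.-1.

Definition dlog (t : F) : nat := index t [seq w ^+ k | k <- iota 0 #|F|.-1].

Lemma prim_neq0 : w != 0.
Proof.
apply/eqP => w0; have := prim_expr_order w_prim; rewrite w0 expr0n.
by rewrite eqn0Ngt (prim_order_gt0 w_prim) /=; move/eqP; rewrite eq_sym oner_eq0.
Qed.

Lemma dlogK t : t != 0 -> w ^+ dlog t = t.
Proof.
move=> t0; have tn : t ^+ n = 1 by exact: finField_expr1.
have [[k ltk] /= def_t] := prim_rootP w_prim tn.
have t_in : t \in [seq w ^+ k | k <- iota 0 n].
  by rewrite def_t; apply: map_f; rewrite mem_iota.
have := nth_index 0 t_in; rewrite (nth_map 0%N) ?nth_iota ?size_iota ?add0n //.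
  by move: t_in; rewrite -index_mem size_map size_iota.
by move: t_in; rewrite -index_mem size_map size_iota.
Qed.

Variable K : comNzRingType.
Implicit Type z : K.

(** For [z ^+ n = 1], the multiplicative character with values in [K] that sends
    the generator [w] to [z].  The quadratic character is [chi (-1)], with values in
    the integers or in a field; a quartic one is [chi iota] with
    [iota ^+ 2 = -1]. *)
Definition chi z (t : F) : K := if t == 0 then 0 else z ^+ dlog t.

Lemma chi0 z : chi z 0 = 0.
Proof. by rewrite /chi eqxx. Qed.

Lemma chi_prim z k : z ^+ n = 1 -> chi z (w ^+ k) = z ^+ k.
Proof.
move=> zn; have wk0 : w ^+ k != 0 by rewrite expf_neq0 ?prim_neq0.
rewrite /chi (negPf wk0); have /eqP := dlogK wk0; rewrite (eq_prim_root_expr w_prim).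
by rewrite -(expr_mod _ zn) => /eqP->; rewrite expr_mod.
Qed.

Lemma chi1 z : z ^+ n = 1 -> chi z 1 = 1.
Proof. by move=> zn; rewrite -(expr0 w) chi_prim. Qed.

Lemma chiM z s t : z ^+ n = 1 -> chi z (s * t) = chi z s * chi z t.
Proof.
move=> zn; have [->|s0] := eqVneq s 0; first by rewrite mul0r chi0 mul0r.
have [->|t0] := eqVneq t 0; first by rewrite mulr0 chi0 mulr0.
by rewrite -{1}(dlogK s0) -{1}(dlogK t0) -exprD chi_prim // exprD /chi (negPf s0) (negPf t0).
Qed.

Lemma chiX z t k : chi z t ^+ k.+1 = chi (z ^+ k.+1) t.
Proof. by rewrite /chi; case: eqP => _; rewrite ?expr0n // exprAC. Qed.

Lemma chi_mulV z t : z ^+ n = 1 -> t != 0 -> chi z t * chi z t^-1 = 1.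
Proof. by move=> zn t0; rewrite -chiM // divff // chi1. Qed.

End PowerCharacters.

Lemma rmorph_chi (F : finFieldType) (w : F) (K L : comNzRingType)
    (f : {rmorphism K -> L}) z t : f (chi w z t) = chi w (f z) t.
Proof. by rewrite /chi; case: eqP => _; rewrite ?rmorph0 ?rmorphXn. Qed.

Lemma chi_sum0 (F : finFieldType) (w : F) (K : idomainType) (z : K) :
    (#|F|.-1).-primitive_root w -> z ^+ #|F|.-1 = 1 -> z != 1 ->
  \sum_t chi w z t = 0.
Proof.
move=> w_prim zn z1; have w0 := prim_neq0 w_prim.
have chi_gen : chi w z w = z by have := chi_prim w_prim 1 zn; rewrite !expr1.
have : (1 - z) * \sum_t chi w z t = 0.
  rewrite mulrBl mul1r; apply/eqP; rewrite subr_eq0; apply/eqP.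
  rewrite [LHS](reindex_inj (mulfI w0)) mulr_sumr; apply: eq_bigr => t _.
  by rewrite chiM // chi_gen.
by move/eqP; rewrite mulf_eq0 subr_eq0 [1 == z]eq_sym (negPf z1) /= => /eqP.
Qed.

(** * The quadratic character and Jacobsthal sums *)

(** Throughout, 4 divides [#|F| - 1], so that [-1] is a square and [eta] is
    even. *)
Section QuadraticCharacter.

Variables (F : finFieldType) (w : F).
Hypotheses (w_prim : (#|F|.-1).-primitive_root w) (dvd4n : (4 %| #|F|.-1)%N).

Notation n := (#|F|.-1).
Notation eta := (chi w (-1 : int)).

Let n_gt0 : (0 < n)%N. Proof. exact: prim_order_gt0 w_prim. Qed.
Let n_def : n = (4 * (n %/ 4))%N. Proof. by rewrite mulnC divnK. Qed.

Lemma quarter_gt0 : (0 < n %/ 4)%N.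
Proof. by rewrite divn_gt0 // dvdn_leq. Qed.

Let n4_gt0 := quarter_gt0.

Lemma fourth_unity_expr (K : nzRingType) (z : K) : z ^+ 4 = 1 -> z ^+ n = 1.
Proof. by move=> z4; rewrite n_def exprM z4 expr1n. Qed.

Lemma neg1_expr (K : nzRingType) : (-1 : K) ^+ n = 1.
Proof. by apply: fourth_unity_expr; rewrite -signr_odd. Qed.

Lemma prim_quarter_sqr : (w ^+ (n %/ 4)) ^+ 2 = -1.
Proof.
have /eqP : (w ^+ (n %/ 4)) ^+ 2 ^+ 2 = 1.
  by rewrite -!exprM (_ : (_ * _)%N = n) ?prim_expr_order //; lia.
rewrite sqrf_eq1 => /orP[|/eqP //]; rewrite -exprM -(prim_order_dvd w_prim).
by move=> /dvdn_leq; lia.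
Qed.

Lemma neg1_neq1 : (-1 : F) != 1.
Proof.
apply/eqP => e; have /eqP := prim_quarter_sqr; rewrite e -exprM -(prim_order_dvd w_prim).
by move=> /dvdn_leq; lia.
Qed.

Lemma two_neq0 : (2%:R : F) != 0.
Proof.
apply: contraNneq neg1_neq1 => e.
by rewrite -subr_eq0 -opprD -[1 + 1]/(2%:R) e oppr0.
Qed.

Lemma eta_sqr1 t : t != 0 -> eta t ^+ 2 = 1.
Proof. by move=> t0; rewrite chiX /chi (negPf t0) sqrrN !expr1n. Qed.

Lemma etaM s t : eta (s * t) = eta s * eta t.
Proof. by rewrite chiM ?neg1_expr. Qed.

Lemma eta_exp2 t : t != 0 -> eta (t ^+ 2) = 1.
Proof. by move=> t0; rewrite expr2 etaM -expr2 eta_sqr1. Qed.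

Lemma eta_neg1 : eta (-1) = 1.
Proof.
rewrite -prim_quarter_sqr eta_exp2 // expf_neq0 //.
exact: prim_neq0 w_prim.
Qed.

Lemma etaN t : eta (- t) = eta t.
Proof. by rewrite -[- t]mulN1r etaM eta_neg1 mul1r. Qed.

Lemma eta_sum0 : \sum_t eta t = 0.
Proof. by apply: chi_sum0 => //; apply: neg1_expr. Qed.

(** The square and nonsquare cases come with an explicit representative of the
    class modulo squares, because Jacobsthal sums are compared within such a
    class. *)
Variant eta_spec t : int -> Type :=
| EtaZero of t = 0 : eta_spec t 0
| EtaSquare c of c != 0 & t = c ^+ 2 : eta_spec t 1
| EtaNonsquare c of c != 0 & t = w * c ^+ 2 : eta_spec t (-1).

Lemma etaP t : eta_spec t (eta t).
Proof.
rewrite /chi; case: eqVneq => [->|t0]; first by constructor.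
have w0 := prim_neq0 w_prim; have := dlogK w_prim t0; move: (dlog w t) => k def_t.
have wk := odd_double_half k; rewrite -signr_odd.
have c0 : w ^+ k./2 != 0 by rewrite expf_neq0.
case: (odd k) wk => wk; [apply: (EtaNonsquare c0) | apply: (EtaSquare c0)].
  by rewrite -def_t -{1}wk -exprM muln2 exprD expr1.
by rewrite -def_t -{1}wk -exprM muln2 add0n.
Qed.

Lemma eta_gen : eta w = -1.
Proof. by have := chi_prim w_prim 1 (neg1_expr int); rewrite !expr1. Qed.

Lemma card_sqrt c : (#|[set y : F | y ^+ 2 == c]|%:Z = 1 + eta c).
Proof.
case: etaP => [->|s s0 ->|s s0 def_c].
- rewrite (_ : [set y | _] = [set 0]) ?cards1 //.
  by apply/setP => y; rewrite !inE sqrf_eq0.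
- rewrite (_ : [set y | _] = [set s; - s]) ?cards2; last first.
    by apply/setP => y; rewrite !inE eqf_sqr.
  suff -> : s != - s by [].
  by rewrite -addr_eq0 -mulr2n -mulr_natr mulf_neq0 // two_neq0.
rewrite (_ : [set y | _] = finset.set0) ?cards0 //.
apply/setP => y; rewrite !inE; apply/negP => /eqP def_y.
have y0 : y != 0.
  apply/eqP => e; move: def_y; rewrite e expr0n /= def_c => /esym/eqP.
  by rewrite mulf_eq0 (negPf (prim_neq0 w_prim)) expf_eq0 (negPf s0) andbF.
by have := eta_exp2 y0; rewrite def_y def_c etaM eta_gen eta_exp2.
Qed.

(** The number of points of a conic, in the form of a character sum: after a
    translation the summand is [eta (D (D + d)) = eta (1 + d / D)]. *)
Lemma sum_eta_shift u v :
  \sum_D eta ((D + u) * (D + v)) = if u == v then n%:Z else -1.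
Proof.
rewrite (reindex_inj (addIr (- u))) /=.
under eq_bigr do rewrite subrK -addrA.
case: eqVneq => [->|neq_uv].
  rewrite addNr (bigD1 0) //= mul0r chi0 add0r.
  rewrite (eq_bigr (fun=> 1)) => [|D D0]; last by rewrite addr0 -expr2 eta_exp2.
  by rewrite sumr_const cardC1 natz.
have wv0 : - u + v != 0 by rewrite addrC subr_eq0 eq_sym.
move: (- u + v) wv0 => d d0.
rewrite (bigD1 0) //= mul0r chi0 add0r.
(* For [D != 0] the summand is [eta (1 + d / D)], and [1 + d / D] takes every value but 1. *)
rewrite (eq_bigr (fun D => eta (1 + d / D))) => [|D D0]; last first.
  rewrite (_ : D * (D + d) = D ^+ 2 * (1 + d / D)); last by field.
  by rewrite etaM eta_exp2 ?mul1r.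
have := eta_sum0; rewrite (bigD1 1) //= chi1 ?neg1_expr // => /eqP.
rewrite addrC addr_eq0 => /eqP sum_neq1; rewrite -[RHS]sum_neq1.
rewrite [RHS](reindex_onto (fun D => 1 + d / D) (fun s => d / (s - 1))) /=; last first.
  by move=> s s1; field; rewrite subr_eq0 s1.
apply: eq_bigl => D; have [->|D0] := eqVneq D 0.
  by rewrite invr0 mulr0 addr0 eqxx.
rewrite -subr_eq0 addrAC subrr add0r mulf_eq0 invr_eq0 (negPf d0) (negPf D0) /=.
by rewrite invfM invrK mulrA divff // mul1r eqxx.
Qed.

(** For [F] the field with [p] elements this is minus the trace of Frobenius of
    [y^2 = x^3 + D x]. *)
Definition jacobsthal (D : F) : int := \sum_x eta (x ^+ 3 + D * x).

(** Substitute [c x] for [x]: the quadratic twist by [c] is the curve with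
    parameter [c ^+ 2 * D]. *)
Lemma jacobsthal_scale c D : c != 0 -> jacobsthal (c ^+ 2 * D) = eta c * jacobsthal D.
Proof.
move=> c0; rewrite /jacobsthal (reindex_inj (mulfI c0)) mulr_sumr.
apply: eq_bigr => x _.
rewrite (_ : _ + _ = c ^+ 2 * (c * (x ^+ 3 + D * x))); last by ring.
by rewrite etaM eta_exp2 // mul1r etaM.
Qed.

Lemma jacobsthal0 : jacobsthal 0 = 0.
Proof.
rewrite /jacobsthal -[RHS]eta_sum0; apply: eq_bigr => x _.
have [->|x0] := eqVneq x 0; first by rewrite mul0r addr0 expr0n.
by rewrite mul0r addr0 exprS etaM eta_exp2 // mulr1.
Qed.

(** Expanding the square and summing over [D] first leaves, by
    [sum_eta_shift], only the pairs [y = x] and [y = - x]. *)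
Lemma sum_jacobsthal_sqr :
  \sum_D jacobsthal D ^+ 2 = 2 * (#|F|%:Z * n%:Z).
Proof.
transitivity (\sum_x \sum_y eta (x * y) *
    \sum_D eta ((D + x ^+ 2) * (D + y ^+ 2))).
  under eq_bigr do rewrite expr2 /jacobsthal mulr_suml.
  rewrite exchange_big; apply: eq_bigr => x _.
  under eq_bigr do rewrite mulr_sumr.
  rewrite exchange_big; apply: eq_bigr => y _.
  rewrite mulr_sumr; apply: eq_bigr => D _; rewrite -!etaM; congr eta; ring.
have eta_mul_sum0 x : \sum_y eta (x * y) = 0.
  by under eq_bigr do rewrite etaM; rewrite -mulr_sumr eta_sum0 mulr0.
transitivity (\sum_(x : F | x != 0) (2 * #|F|%:Z)); last first.
  by rewrite sumr_const cardC1 -mulr_natr; ring.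
rewrite (bigD1 0) //= big1 ?add0r => [|y _]; last by rewrite mul0r chi0 mul0r.
apply: eq_bigr => x x0.
transitivity (\sum_y (eta (x * y) * (if x ^+ 2 == y ^+ 2 then #|F|%:Z else 0) - eta (x * y))).
  apply: eq_bigr => y _; rewrite sum_eta_shift; case: eqP => _; last by rewrite mulr0 mulrN1 add0r.
  by rewrite -{2}(ltn_predK (finNzRing_gt1 F)) -[n.+1]addn1 PoszD mulrDr mulr1 addrK.
rewrite big_split /= sumrN eta_mul_sum0 subr0.
have neq_x : - x != x.
  by rewrite eq_sym -addr_eq0 -mulr2n -mulr_natr mulf_neq0 // two_neq0.
rewrite (bigD1 x) //= (bigD1 (- x)) //= big1 => [|y /andP[y1 y2]]; last first.
  by rewrite eq_sym eqf_sqr (negPf y1) (negPf y2) mulr0.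
rewrite sqrrN eqxx mulrN etaN -expr2 eta_exp2 //; ring.
Qed.

(** By [jacobsthal_scale] the square of the sum takes one value on squares and
    another on nonsquares, so the second moment determines the sum of the two
    values. *)
Lemma jacobsthal_sqr_sum :
  jacobsthal (-1) ^+ 2 + jacobsthal w ^+ 2 = 4 * #|F|%:Z.
Proof.
have n0 : n%:Z != 0 by rewrite -lt0n.
apply: (mulfI n0); rewrite (_ : _ * (4 * _) = 2 * (2 * (#|F|%:Z * n%:Z))); last by ring.
rewrite -sum_jacobsthal_sqr (bigD1 0) //= jacobsthal0 expr0n add0r mulr_sumr.
transitivity (\sum_(D | D != 0) ((1 + eta D) * jacobsthal (-1) ^+ 2
    + (1 - eta D) * jacobsthal w ^+ 2)).
  rewrite big_split /= -!mulr_suml !big_split /= sumrN.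
  have := eta_sum0; rewrite (bigD1 0) //= chi0 add0r => ->.
  by rewrite !sumr_const cardC1 natz; ring.
apply: eq_bigr => D; case: etaP => [->|c c0 ->|c c0 ->] D0; first by rewrite eqxx in D0.
  have [i i2] : exists i : F, i ^+ 2 = -1 by exists (w ^+ (n %/ 4)); exact: prim_quarter_sqr.
  have i0 : i != 0 by apply/eqP => e; move/eqP: i2; rewrite e expr0n eq_sym oppr_eq0 oner_eq0.
  rewrite (_ : c ^+ 2 = (i * c) ^+ 2 * -1); last by rewrite exprMn i2; ring.
  rewrite jacobsthal_scale ?mulf_neq0 // exprMn eta_sqr1 ?mulf_neq0 //; ring.
rewrite [w * _]mulrC jacobsthal_scale // exprMn eta_sqr1 //; ring.
Qed.

End QuadraticCharacter.

(** * The curve y^2 = x^3 - x modulo 8 *)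

Section CongruentCurveModEight.

Variables (F : finFieldType) (w : F).
Hypotheses (w_prim : (#|F|.-1).-primitive_root w) (dvd4n : (4 %| #|F|.-1)%N).

Notation n := (#|F|.-1).
Notation eta := (chi w (-1 : int)).

(** The left side is the number of points of [y^2 = x^3 - x].  The points with
    [y != 0] come in pairs, so the set [X] of their abscissas has to be counted
    modulo 4.  The group generated by [x -> - x] and [x -> x^-1] acts on [X], and
    all its orbits have four elements except the orbit of the square roots of
    [-1], which has two. *)
Lemma jacobsthal_neg1_mod8 : (8 %| #|F|%:Z + 1 + jacobsthal w (-1)%R)%Z.
Proof.
have w0 := prim_neq0 w_prim.
have two0 := two_neq0 w_prim dvd4n; have N1 := neg1_neq1 w_prim dvd4n.
have etaM := etaM w_prim dvd4n; have eta_exp2 := eta_exp2 w_prim dvd4n.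
have nz_opp (x : F) : x != 0 -> x != - x.
  by move=> x0; rewrite -addr_eq0 -mulr2n -mulr_natr mulf_neq0.
pose i := w ^+ (n %/ 4); have i2 : i ^+ 2 = -1 by exact: prim_quarter_sqr.
have i0 : i != 0 by rewrite expf_neq0.
pose f (x : F) := x ^+ 3 + -1 * x.
have fE x : f x = x * (x ^+ 2 - 1) by rewrite /f; ring.
pose X := [set x | eta (f x) == 1]; pose X' := X :\: [set i; - i].
have fi c : c ^+ 2 = -1 -> eta (f c) = 1.
  move=> c2; rewrite fE c2 (_ : _ * _ = (1 - c) ^+ 2); last first.
    by rewrite sqrrB c2 expr1n; ring.
  rewrite eta_exp2 // subr_eq0 eq_sym; apply: contraNneq N1 => c1.
  by rewrite -c2 c1 expr1n.
have iX : [set i; - i] \subset X.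
  by apply/fintype.subsetP => x /set2P[->|->]; rewrite inE fi ?sqrrN.
have cardX : #|X| = (2 + #|X'|)%N.
  by rewrite -(cardsID [set i; - i] X) (finset.setIidPr iX) cards2 nz_opp.
have dvdX' : (4 %| #|X'|)%N.
  (* The fibres of this invariant are the orbits [a, - a, a^-1, - a^-1]. *)
  pose h (x : F) := x ^+ 2 + x ^- 2.
  rewrite -sum1_card (partition_big h predT) //=; apply: dvdn_sum => c _.
  case: (pickP [pred x in X' | h x == c]) => [a|no_x]; last by rewrite big_pred0.
  rewrite /= => /andP[a_in /eqP <-].
  move: (a_in); rewrite !inE negb_or => /andP[/andP[ai aNi] fa].
  have a0 : a != 0.
    by apply/eqP => e; move: fa; rewrite e fE mul0r chi0 // eq_sym oner_eq0.
  have a21 : a ^+ 2 != 1.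
    by apply/eqP => e; move: fa; rewrite fE e subrr mulr0 chi0 // eq_sym oner_eq0.
  have a2i : a ^+ 2 != -1 by rewrite -i2 eqf_sqr negb_or ai aNi.
  rewrite (eq_bigl (mem [:: a; - a; a^-1; - a^-1])) => [|x].
    rewrite sum1_card; suff /card_uniqP-> : uniq [:: a; - a; a^-1; - a^-1] by [].
    rewrite /=.
    rewrite !inE !negb_or (inj_eq oppr_inj) nz_opp // nz_opp ?invr_eq0 // !andbT.
    rewrite eqr_oppLR.
    have -> : a != a^-1.
      by apply: contraNneq a21 => e; rewrite expr2 {2}e divff.
    have -> // : a != - a^-1.
    by apply: contraNneq a2i => e; rewrite expr2 {2}e mulrN divff.
  apply/idP/idP.
    move=> /andP[]; rewrite !inE negb_or => /andP[/andP[xi xNi] fx] /eqP hx.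
    have x0 : x != 0.
      by apply/eqP => e; move: fx; rewrite e fE mul0r chi0 // eq_sym oner_eq0.
    have : (x ^+ 2 - a ^+ 2) * (x ^+ 2 - a^-1 ^+ 2) = 0.
      transitivity (x ^+ 2 * (h x - h a)); last by rewrite hx subrr mulr0.
      by rewrite /h; field; rewrite a0 x0.
    move/eqP; rewrite mulf_eq0 !subr_eq0 !eqf_sqr => /orP[/orP[]|/orP[]] ->;
      by rewrite ?orbT.
  have fN y : eta (f (- y)) = eta (f y).
    by rewrite !fE sqrrN mulNr etaN.
  have hN y : h (- y) = h y by rewrite /h -exprVn invrN !sqrrN exprVn.
  have fV y : y != 0 -> eta (f y^-1) = eta (f y).
    move=> y0; rewrite -fN (_ : f (- y^-1) = (y^-1 ^+ 2) ^+ 2 * f y); last first.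
      by rewrite /f; field.
    by rewrite etaM eta_exp2 ?mul1r // expf_neq0 // invr_eq0.
  have hV y : h y^-1 = h y by rewrite /h exprVn invrK addrC.
  have iV : i^-1 = - i.
    by apply: (mulfI i0); rewrite divff // mulrN -expr2 i2 opprK.
  have inN y : y \in X' -> - y \in X'.
    by rewrite !inE fN eqr_oppLR eqr_opp orbC.
  have inV y : y != 0 -> y \in X' -> y^-1 \in X'.
    have yi : (y^-1 == i) = (y == - i) by rewrite -iV -[RHS](inj_eq invr_inj) invrK.
    have yNi : (y^-1 == - i) = (y == i) by rewrite -iV (inj_eq invr_inj).
    by move=> y0; rewrite !inE fV // yi yNi orbC.
  rewrite -[X in is_true X -> _]/(x \in [:: a; - a; a^-1; - a^-1]) !in_cons in_nil orbF.
  move=> /or4P[]/eqP->; rewrite ?hN ?hV eqxx andbT;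
   do ?[apply: inN | apply: inV => //]; exact: a_in.
have sum_f : #|F|%:Z + jacobsthal w (-1) = 3 + 2 * #|X|%:Z.
  have -> : (3 : int) = #|[set x | f x == 0]|%:Z.
    have -> : [set x | f x == 0] = [set x in [:: 0; 1; -1]].
      by apply/setP => x; rewrite !inE fE mulf_eq0 subr_eq0 sqrf_eq1.
    rewrite cardsE; congr Posz; apply/esym/card_uniqP.
    by rewrite /= !inE negb_or eq_sym oner_eq0 eq_sym oppr_eq0 oner_eq0 eq_sym N1.
  have cardE (P : pred F) : #|[set x | P x]|%:Z = \sum_x (P x : nat)%:Z.
    rewrite -sum1_card -natz natr_sum big_mkcond /=.
    by apply: eq_bigr => x _; rewrite inE; case: (P x).
  rewrite !cardE mulr_sumr -big_split /= -[#|F|]sum1_card -natz natr_sum -big_split /=.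
  apply: eq_bigr => x _; rewrite -/(f x); case: etaP => // [->|c c0 ->|c c0 ->] //.
  - by rewrite eqxx.
  - by rewrite expf_eq0 (negPf c0).
  by rewrite mulf_eq0 (negPf w0) expf_eq0 (negPf c0).
by rewrite addrAC sum_f cardX; lia.
Qed.

End CongruentCurveModEight.

(** * Jacobsthal sums over a prime field *)

Section TraceOfFrobenius.

Variables (p : nat) (w : 'F_p) (alpha : int) (y : nat).
Hypotheses (p_pr : prime p) (w_prim : (#|'F_p|.-1).-primitive_root w).
Hypotheses (alpha1 : (alpha = 1 %[mod 4])%Z) (def_p : p%:Z = alpha ^+ 2 + 4 * y%:Z ^+ 2).

Lemma dvd4_two_squares : (4 %| #|'F_p|.-1)%N.
Proof.
rewrite card_Fp //; have [k def_a] := eq1_mod4_rep alpha1.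
have : p%:Z = 1 + 4 * (2 * k + 4 * k ^+ 2 + y%:Z ^+ 2) by rewrite def_p def_a; ring.
by move: (2 * k + _ + _) (prime_gt0 p_pr); clear; lia.
Qed.

Let dvd4 := dvd4_two_squares.

(** [jacobsthal_sqr_sum] writes [p] as a sum of two squares, so uniqueness gives
    the sum up to sign; the congruence modulo 8 then chooses the sign. *)
Lemma jacobsthal_neg1 : jacobsthal w (-1) = - (2 * alpha * (-1) ^+ y).
Proof.
have := jacobsthal_sqr_sum w_prim dvd4; have := jacobsthal_neg1_mod8 w_prim dvd4.
rewrite card_Fp //; move: (jacobsthal w (-1)) (jacobsthal w w) => S T /dvdzP[j def_S] sq.
have [k def_a] := eq1_mod4_rep alpha1.
(* Half of [S], read off from [p + 1 + S = 8 j] and [alpha = 1 + 4 k]. *)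
pose A := 4 * (j - k - 2 * k ^+ 2) - 1 - 2 * y%:Z ^+ 2.
have S_A : S = 2 * A.
  have -> : S = j * 8 - 1 - p%:Z by rewrite -def_S; ring.
  by rewrite def_p def_a /A; ring.
have A_odd : ~~ (2 %| A)%Z.
  rewrite (_ : A = 2 * (2 * (j - k - 2 * k ^+ 2) - 1 - y%:Z ^+ 2) + 1) /A; last by ring.
    by move: (_ - 1 - _); clear; lia.
have T_even : (2 %| T)%Z.
  have : (2 %| T ^+ 2)%Z.
    apply/dvdzP; exists (2 * p%:Z - 2 * A ^+ 2).
    rewrite [RHS](_ : _ = 4 * p%:Z - (2 * A) ^+ 2); last by ring.
    by rewrite -S_A -sq; ring.
  by rewrite !dvdzE abszX Euclid_dvdX // => /andP[].
have [B T_B] := dvdzP T_even.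
have def_AB : p%:Z = A ^+ 2 + B ^+ 2.
  apply: (@mulfI _ (4 : int)) => //.
  by rewrite -sq S_A T_B; ring.
have p_odd : odd p.
  by have := dvd4; have := prime_gt1 p_pr; rewrite card_Fp //; clear; lia.
have def_p2 : p%:Z = alpha ^+ 2 + (2 * y%:Z) ^+ 2 by rewrite def_p; ring.
have /eqP := prime_two_squares_odd p_pr p_odd def_AB def_p2 A_odd (eq1_mod4_odd alpha1).
rewrite eqf_sqr => A_al; rewrite S_A -signr_odd.
have := odd_double_half y; move: (y./2) A_al => h A_al; case: (odd y) => def_y.
  have [t def_A] : exists t, A = 4 * t - 3.
    exists (j - k - 2 * k ^+ 2 - 2 * h%:Z ^+ 2 - 2 * h%:Z).
    rewrite /A; have -> : y%:Z = 1 + 2 * h%:Z by rewrite -def_y; clear; lia.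
    by ring.
  by move: A_al; rewrite def_A def_a expr1; clear; lia.
have [t def_A] : exists t, A = 4 * t - 1.
  exists (j - k - 2 * k ^+ 2 - 2 * h%:Z ^+ 2).
  rewrite /A; have -> : y%:Z = 2 * h%:Z by rewrite -def_y; clear; lia.
  by ring.
by move: A_al; rewrite def_A def_a expr0; clear; lia.
Qed.

Lemma jacobsthal_gen_sqr : jacobsthal w w ^+ 2 = 16 * y%:Z ^+ 2.
Proof.
have := jacobsthal_sqr_sum w_prim dvd4.
rewrite jacobsthal_neg1 sqrrN !exprMn sqrr_sign mulr1 card_Fp // def_p.
by rewrite addrC => /(canRL (addrK _)) ->; ring.
Qed.

(** The hypothesis says that [- D = c^2] with [eta c = (-1)^b]. *)
Lemma jacobsthal_quartic D b :
  (- D) ^+ (#|'F_p|.-1 %/ 4) = (-1) ^+ b -> jacobsthal w D = - (2 * alpha * (-1) ^+ (y + b)).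
Proof.
rewrite -[D in jacobsthal w D]opprK; move: (- D) => {}D hD.
have D0 : D != 0.
  apply: contra_eq_neq hD => ->; rewrite expr0n gtn_eqF ?(quarter_gt0 w_prim) //.
  by rewrite eq_sym signr_eq0.
have j2 := prim_quarter_sqr w_prim dvd4; have N1 := neg1_neq1 w_prim dvd4.
have etaE k : chi w (-1 : int) (w ^+ k) = (-1) ^+ k by apply: chi_prim => //; apply: neg1_expr.
move/eqP: hD; rewrite -{1}(dlogK w_prim D0) exprAC expr_sqrtN1 // => log_b.
have [l def_log odd_l] : exists2 l, dlog w D = (l * 2)%N & odd l = odd b.
  by exists (dlog w D)./2; move: log_b; clear; lia.
have -> : - D = (w ^+ l) ^+ 2 * -1 by rewrite mulrN1 -exprM -def_log dlogK.
rewrite jacobsthal_scale ?expf_neq0 ?(prim_neq0 w_prim) //.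
by rewrite jacobsthal_neg1 etaE exprD -signr_odd odd_l signr_odd; ring.
Qed.

Lemma jacobsthal_nonsquare D :
  (- D) ^+ (#|'F_p|.-1 %/ 4 * 2) = -1 -> jacobsthal w D ^+ 2 = 16 * y%:Z ^+ 2.
Proof.
have N1 := neg1_neq1 w_prim dvd4.
rewrite -jacobsthal_gen_sqr exprM exprAC sqrrN => hD.
case: (etaP w_prim D) => [D0|c c0 D0|c c0 ->].
- move: hD; rewrite D0 expr0n expr0n gtn_eqF ?(quarter_gt0 w_prim) // => /eqP.
  by rewrite eq_sym oppr_eq0 oner_eq0.
- move: hD; rewrite D0 -!exprM mulnA mulnC divnK //.
  by move=> /eqP; rewrite finField_expr1 // eq_sym (negPf N1).
by rewrite mulrC jacobsthal_scale // exprMn eta_sqr1 // mul1r.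
Qed.

End TraceOfFrobenius.

(** * Gauss and Jacobi sums *)

(** Gauss sums with values in an arbitrary field [K] that contains an additive
    character of [F]; [K] will have positive characteristic. *)
Section GaussSums.

Variables (F : finFieldType) (w : F) (K : fieldType) (psi : F -> K).
Hypothesis w_prim : (#|F|.-1).-primitive_root w.
Hypotheses (psiD : {morph psi : s t / s + t >-> s * t}) (psi_sum0 : \sum_t psi t = 0).
Hypothesis psi0 : psi 0 = 1.

Notation n := (#|F|.-1).
Notation q := (#|F|%:R : K).

Definition gauss (z : K) : K := \sum_t chi w z t * psi t.

Definition jacobi (z z' : K) : K := \sum_t chi w z t * chi w z' (1 - t).

Lemma sum_psi a : \sum_t psi (a * t) = if a == 0 then q else 0.
Proof.
case: eqVneq => [->|a0]; last by rewrite -[RHS]psi_sum0 [RHS](reindex_inj (mulfI a0)).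
by under eq_bigr do rewrite mul0r psi0; rewrite sumr_const.
Qed.

Lemma gauss_twist z a : z ^+ n = 1 -> a != 0 ->
  \sum_t chi w z t * psi (a * t) = chi w z a^-1 * gauss z.
Proof.
move=> zn a0; rewrite /gauss [in RHS](reindex_inj (mulfI a0)) mulr_sumr.
by apply: eq_bigr => t _; rewrite mulrA -chiM // mulKf.
Qed.

Lemma gauss_inv z z' : z ^+ n = 1 -> z' ^+ n = 1 -> z != 1 -> z * z' = 1 ->
  gauss z * gauss z' = chi w z (-1) * q.
Proof.
move=> zn z'n z1 zz'.
transitivity (\sum_(t | t != 0) \sum_u chi w z u * psi ((u + 1) * t)).
  rewrite mulrC mulr_suml (bigD1 0) //= chi0 !mul0r add0r; apply: eq_bigr => t t0.
  rewrite mulr_sumr (reindex_inj (mulIf t0)); apply: eq_bigr => u _.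
  rewrite mulrDl mul1r psiD chiM // {1 3}/chi (negPf t0).
  rewrite [LHS](_ : _ = (z * z') ^+ dlog w t * chi w z u * (psi (u * t) * psi t)); last first.
    by rewrite exprMn; ring.
  by rewrite zz' expr1n mul1r.
rewrite exchange_big /=.
transitivity (\sum_u chi w z u * ((if u + 1 == 0 then q else 0) - 1)).
  apply: eq_bigr => u _; rewrite -mulr_sumr -sum_psi [X in _ = _ * (X - 1)](bigD1 0) //=.
  by rewrite mulr0 psi0 addrAC subrr add0r.
under eq_bigr do rewrite mulrBr mulr1.
rewrite sumrB chi_sum0 // subr0 (bigD1 (-1)) //= addNr eqxx big1 ?addr0 // => u.
by rewrite -subr_eq0 opprK => /negPf->; rewrite mulr0.
Qed.

Lemma gauss_mul z z' : z ^+ n = 1 -> z' ^+ n = 1 -> z * z' != 1 ->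
  gauss z * gauss z' = jacobi z z' * gauss (z * z').
Proof.
move=> zn z'n zz'.
have chi_mul t : chi w z t * chi w z' t = chi w (z * z') t.
  by rewrite /chi; case: eqP => _; rewrite ?mul0r // exprMn.
transitivity (\sum_v \sum_s chi w z s * chi w z' (v - s) * psi v).
  rewrite exchange_big mulr_suml; apply: eq_bigr => s _.
  rewrite mulr_sumr [RHS](reindex_inj (addIr s)); apply: eq_bigr => t _ /=.
  by rewrite addrK addrC psiD; ring.
rewrite mulr_sumr; apply: eq_bigr => v _; rewrite -mulr_suml mulrA; congr (_ * _).
have [->|v0] := eqVneq v 0.
  rewrite chi0 mulr0; transitivity (\sum_s chi w z' (-1) * chi w (z * z') s).
    by apply: eq_bigr => s _; rewrite sub0r -[- s]mulN1r (chiM w_prim (-1)) // mulrCA chi_mul.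
  by rewrite -mulr_sumr chi_sum0 ?mulr0 // exprMn zn z'n mulr1.
rewrite (reindex_inj (mulfI v0)) mulr_suml; apply: eq_bigr => s _.
by rewrite -{2}[v]mulr1 -mulrBr !chiM // -chi_mul; ring.
Qed.

(** The Frobenius of [K] raises each term of the sum to the power [l], which
    raises [z] to the power [l] and multiplies the argument of [psi] by [l]. *)
Lemma gauss_frobenius l z : l \in [pchar K] -> z ^+ n = 1 -> (l%:R : F) != 0 ->
  gauss z ^+ l = chi w (z ^+ l) l%:R^-1 * gauss (z ^+ l).
Proof.
move=> charKl zn l0; rewrite -gauss_twist //; last by rewrite exprAC zn expr1n.
rewrite -(pFrobenius_autE charKl) /gauss rmorph_sum; apply: eq_bigr => t _ /=.
rewrite pFrobenius_autE exprMn; congr (_ * _).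
  by case: l {charKl l0} (prime_gt0 (pcharf_prime charKl)) => // l _; rewrite chiX.
rewrite mulr_natl; elim: {l0 charKl} l => [|l IHl]; first by rewrite expr0 mulr0n psi0.
by rewrite exprS mulrS psiD IHl.
Qed.

End GaussSums.

Section QuarticGaussSum.

Variables (F : finFieldType) (w : F) (K : fieldType) (psi : F -> K) (iota : K).
Hypotheses (w_prim : (#|F|.-1).-primitive_root w) (dvd4n : (4 %| #|F|.-1)%N).
Hypotheses (psiD : {morph psi : s t / s + t >-> s * t}) (psi_sum0 : \sum_t psi t = 0).
Hypotheses (psi0 : psi 0 = 1) (iota2 : iota ^+ 2 = -1).
Hypotheses (q_neq0 : (#|F|%:R : K) != 0) (two_neq0K : (2%:R : K) != 0).

Notation q := (#|F|%:R : K).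

Lemma iota_exprn : iota ^+ #|F|.-1 = 1.
Proof. by apply: fourth_unity_expr => //; rewrite -[4%N]/(2 * 2)%N exprM iota2 sqrrN expr1n. Qed.

Lemma neg_iota_exprn : (- iota) ^+ #|F|.-1 = 1.
Proof. by apply: fourth_unity_expr => //; rewrite -[4%N]/(2 * 2)%N exprM sqrrN iota2 sqrrN expr1n. Qed.

Lemma neg1_neq1K : (-1 : K) != 1.
Proof.
apply: contraNneq two_neq0K => e; rewrite mulr2n -[X in X + _]e addrC subrr.
by [].
Qed.

Lemma iota_neq1 : iota != 1.
Proof. by apply: contraNneq neg1_neq1K => e; rewrite -iota2 e expr1n. Qed.

Lemma neg_iota_neq1 : - iota != 1.
Proof. by apply: contraNneq neg1_neq1K => e; rewrite -iota2 -sqrrN e expr1n. Qed.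

Lemma chi_neg1_intr t : chi w (-1 : K) t = (chi w (-1 : int) t)%:~R.
Proof. by rewrite (rmorph_chi w (intr : {rmorphism int -> K})) rmorphN1. Qed.

(** A quartic character and its conjugate add up to the push-forward of the
    quadratic character along [x -> x ^+ 2]; on a nonsquare both sides
    vanish. *)
Lemma chi_iota_sum u : chi w iota u + chi w (- iota) u
  = \sum_(x | x ^+ 2 == u) chi w (-1 : K) x.
Proof.
have w0 := prim_neq0 w_prim.
case: (etaP w_prim u) => [->|c c0 ->|c c0 ->].
- rewrite !chi0 addr0 big1 // => x; rewrite expf_eq0 => /andP[_ /eqP->].
  exact: chi0.
- rewrite (bigD1 c) //= (bigD1 (- c)) /=; last first.
    rewrite sqrrN eqxx eq_sym -addr_eq0 -mulr2n -mulr_natr mulf_neq0 //.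
    exact: two_neq0 w_prim dvd4n.
  rewrite big1 => [|x /andP[/andP[]]]; last first.
    by rewrite eqf_sqr => /orP[]/eqP->; rewrite eqxx.
  rewrite addr0 !chi_neg1_intr etaN // -!chi_neg1_intr.
  rewrite expr2 !chiM ?iota_exprn ?neg_iota_exprn // -!expr2 !chiX sqrrN iota2.
  by [].
rewrite big1 => [|x /eqP def_x]; last first.
  have x0 : x != 0.
    apply/eqP => e; move/esym/eqP: def_x; rewrite e expr0n mulf_eq0 (negPf w0).
    by rewrite expf_eq0 (negPf c0).
  have := eta_exp2 w_prim dvd4n x0; rewrite def_x etaM // eta_gen // eta_exp2 //.
have wE z : z ^+ #|F|.-1 = 1 -> chi w z w = z :> K.
  by move=> zn; have := chi_prim w_prim 1 zn; rewrite !expr1.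
rewrite !chiM ?iota_exprn ?neg_iota_exprn // !wE ?iota_exprn ?neg_iota_exprn //.
by rewrite -!expr2 !chiX sqrrN mulNr subrr.
Qed.

(** Group the terms [eta x * eta (1 - x^2)] of the Jacobsthal sum by the value
    of [x^2]. *)
Lemma jacobi_sum_jacobsthal :
  jacobi w iota (-1) + jacobi w (- iota) (-1) = (jacobsthal w (-1))%:~R.
Proof.
rewrite -big_split /= rmorph_sum /= [RHS](partition_big (fun x => x ^+ 2) predT) //=.
apply: eq_bigr => u _; rewrite -mulrDl chi_iota_sum mulr_suml.
apply: eq_bigr => x /eqP <-.
rewrite !chi_neg1_intr -rmorphM -etaM //; congr (_%:~R).
by rewrite -[in RHS]etaN //; congr (chi _ _ _); ring.
Qed.

Lemma quadratic_gauss_sqr : gauss w psi (-1) ^+ 2 = q.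
Proof.
rewrite expr2 (gauss_inv w_prim) ?neg1_expr ?neg1_neq1K ?mulrNN ?mulr1 //.
by rewrite chi_neg1_intr eta_neg1 // mul1r.
Qed.

Lemma quartic_gauss_inv : gauss w psi iota * gauss w psi (- iota) = chi w iota (-1) * q.
Proof.
rewrite (gauss_inv w_prim) ?iota_exprn ?neg_iota_exprn ?iota_neq1 //.
by rewrite mulrN -expr2 iota2 opprK.
Qed.

Lemma chi_iota_neg1_sqr : chi w iota (-1) ^+ 2 = 1.
Proof. by rewrite expr2 -chiM ?iota_exprn // mulrNN mulr1 chi1 ?iota_exprn. Qed.

(** Let [G], [G'] and [g] be the Gauss sums of [iota], [- iota] and [-1], and
    [J], [J'] the Jacobi sums in [G g = J G'] and [G' g = J' G].  They give
    [J J' = g^2 = q], and the hypothesis says [J' = - J]; hence [J^2 = - q].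
    Squaring [G (G g) = J (G G')], where [G G' = q] up to sign, gives
    [G^4 q = J^2 q^2]. *)
Lemma quartic_gauss_expr4 : (jacobsthal w (-1))%:~R = 0 :> K ->
  gauss w psi iota ^+ 4 = - q ^+ 2.
Proof.
rewrite -jacobi_sum_jacobsthal addrC => /eqP; rewrite addr_eq0 => /eqP J'.
set G := gauss _ _ _; set G' := gauss w psi (- iota); set g := gauss w psi (-1).
set J := jacobi w iota (-1).
have g2 : g ^+ 2 = q := quadratic_gauss_sqr.
have GG' : G * G' = chi w iota (-1) * q := quartic_gauss_inv.
have c2 := chi_iota_neg1_sqr.
have Gg : G * g = J * G'.
  by rewrite /G /g (gauss_mul w_prim) ?iota_exprn ?neg1_expr ?mulrN1 ?neg_iota_neq1.
have G'g : G' * g = - J * G.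
  by rewrite /G' /g (gauss_mul w_prim) ?neg_iota_exprn ?neg1_expr ?mulrNN ?mulr1 ?iota_neq1 // J'.
have G0 : G != 0.
  apply: contraNneq q_neq0 => e; have := GG'; rewrite e mul0r => /esym/eqP.
  rewrite mulf_eq0 (negPf q_neq0) orbF => /eqP c0.
  by move/eqP: c2; rewrite c0 expr0n eq_sym oner_eq0.
have J2 : J ^+ 2 = - q.
  apply: (mulfI G0); rewrite mulrN -g2.
  transitivity (- (J * (- J * G))); first by ring.
  by rewrite -G'g mulrA -Gg; ring.
apply: (mulIf q_neq0); rewrite -{1}g2 (_ : _ * _ = (G * (G * g)) ^+ 2); last by ring.
by rewrite Gg mulrCA GG' !exprMn c2 J2; ring.
Qed.

End QuarticGaussSum.

(** * Quadratic and quartic characters of odd primes *)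

Lemma closed_field_over_Fp (l : nat) : exists K : closedFieldType,
  inhabited {rmorphism 'F_l -> K}.
Proof.
have [K [f _]] := countable_algebraic_closure 'F_l.
by exists K; constructor; exact: f.
Qed.

Lemma closed_exprn_root (K : closedFieldType) (n : nat) (a : K) :
  (0 < n)%N -> exists z : K, z ^+ n = a.
Proof.
move=> n_gt0; have [z def_z] := @solve_monicpoly K n (fun i => if i == 0%N then a else 0) n_gt0.
exists z; rewrite def_z; case: n n_gt0 {def_z} => // n _.
by rewrite big_ord_recl /= mulr1 big1 ?addr0 // => i _; rewrite mul0r.
Qed.

(** The powers of a nontrivial [p]-th root of unity, which is found as a root
    of [1 + X + ... + X^(p - 1)]; 1 is not a root because [p] is not 0 in
    [K]. *)
Lemma additive_character (p : nat) (K : closedFieldType) : prime p ->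
    (p%:R : K) != 0 -> exists psi : 'F_p -> K,
  [/\ {morph psi : s t / s + t >-> s * t}, \sum_t psi t = 0 & psi 0 = 1].
Proof.
move=> p_pr p0; have p_gt1 := prime_gt1 p_pr.
have [z] : exists z : K, root (\poly_(i < p) 1) z.
  by apply/closed_rootP; rewrite size_poly_eq ?oner_eq0 // gtn_eqF.
rewrite /root horner_poly => /eqP sum_z.
have zp : z ^+ p = 1.
  apply/eqP; rewrite -subr_eq0 subrX1.
  by under eq_bigr do rewrite -[_ ^+ _]mul1r; rewrite sum_z mulr0.
have z1 : z != 1.
  apply: contraNneq p0 => e; rewrite -sum_z e.
  by under eq_bigr do rewrite expr1n mulr1; rewrite sumr_const card_ord.
pose psi (t : 'F_p) := z ^+ (t : nat).
have psiD : {morph psi : s t / s + t >-> s * t}.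
  move=> s t; rewrite /psi -exprD /= -[in RHS](expr_mod _ zp); congr (_ ^+ (_ %% _)%N).
  by rewrite Fp_cast.
have psi0 : psi 0 = 1 by [].
exists psi; split=> //; have psi1 : psi 1 = z by rewrite /psi /= Fp_cast // modn_small.
have : (z - 1) * \sum_t psi t = 0.
  rewrite mulrBl mul1r; apply/eqP; rewrite subr_eq0; apply/eqP.
  rewrite [RHS](reindex_inj (addrI 1)) mulr_sumr; apply: eq_bigr => t _.
  by rewrite psiD psi1.
by move/eqP; rewrite mulf_eq0 subr_eq0 (negPf z1) => /eqP.
Qed.

Lemma chi_quartic (F : finFieldType) (w t : F) (K : fieldType) (iota : K) b :
    (#|F|.-1).-primitive_root w -> (4 %| #|F|.-1)%N ->
    (-1 : K) != 1 -> iota ^+ 2 = -1 -> t != 0 ->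
  chi w iota t = (-1) ^+ b -> t ^+ (#|F|.-1 %/ 4) = (-1) ^+ b.
Proof.
move=> w_prim dvd4n N1 iota2 t0; rewrite /chi (negPf t0) => /eqP.
rewrite expr_sqrtN1 // => eq_log; apply/eqP.
rewrite -(dlogK w_prim t0) exprAC expr_sqrtN1 //; first exact: neg1_neq1 w_prim dvd4n.
exact: prim_quarter_sqr.
Qed.

Lemma eta_expr (F : finFieldType) (w t : F) :
    (#|F|.-1).-primitive_root w -> (4 %| #|F|.-1)%N ->
  (chi w (-1 : int) t)%:~R = t ^+ (#|F|.-1 %/ 4 * 2).
Proof.
move=> w_prim dvd4n; have n4 := quarter_gt0 w_prim dvd4n.
case: etaP => // [->|c c0 ->|c c0 ->].
- by rewrite expr0n muln_eq0 orbF gtn_eqF.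
- by rewrite -exprM mulnC -mulnA divnK // finField_expr1.
by rewrite exprMn exprM prim_quarter_sqr // -exprM mulnC -mulnA divnK // finField_expr1 // mulr1.
Qed.

(** For two distinct odd primes, the Gauss sums of the field with [p] elements
    are taken in an algebraic closure of the field with [l] elements, where
    raising to the power [l] is additive. *)
Section QuadraticReciprocity.

Variables (p l : nat) (w : 'F_p).
Hypotheses (p_pr : prime p) (l_pr : prime l) (l_odd : odd l) (neq_lp : l != p).
Hypotheses (w_prim : (#|'F_p|.-1).-primitive_root w) (dvd4n : (4 %| #|'F_p|.-1)%N).

Let l0 : (l%:R : 'F_p) != 0. Proof. exact: Fp_prime_neq0. Qed.

Let p0 : (p%:R : 'F_l) != 0. Proof. by apply: Fp_prime_neq0; rewrite // eq_sym. Qed.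

Lemma Fp_two_neq0 : (2%:R : 'F_l) != 0.
Proof. by rewrite Fp_nat_eq0 // dvdn_prime2 // neq_ltn orbC odd_prime_gt2. Qed.

Let l_half : l = (l./2 * 2).+1.
Proof. by rewrite -[LHS]odd_double_half l_odd muln2. Qed.

(** The quadratic Gauss sum [g] has [g^2 = p], so [g^l = p^((l-1)/2) g], while
    the Frobenius gives [g^l = eta(l) g]. *)
Lemma quadratic_reciprocity : (chi w (-1 : int) l%:R)%:~R = (p%:R : 'F_l) ^+ l./2.
Proof.
have [K [f]] := closed_field_over_Fp l.
have charK : l \in [pchar K] by rewrite (fmorph_pchar f) pchar_Fp.
have pK : (p%:R : K) != 0 by rewrite -(rmorph_nat f) fmorph_eq0 p0.
have twoK : (2%:R : K) != 0 by rewrite -(rmorph_nat f) fmorph_eq0 Fp_two_neq0.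
have [psi [psiD psi_sum0 psi0]] := additive_character p_pr pK.
have g2 := quadratic_gauss_sqr w_prim dvd4n psiD psi_sum0 psi0 twoK.
rewrite card_Fp // in g2; set g := gauss _ _ _ in g2.
have g0 : g != 0 by apply: contraNneq pK => e; rewrite -g2 e expr0n.
apply: (fmorph_inj f); rewrite rmorph_int rmorphXn rmorph_nat -chi_neg1_intr.
apply: (mulIf g0); rewrite -g2 -exprM mulnC -exprSr -l_half.
rewrite (gauss_frobenius w_prim psiD psi0 charK) ?neg1_expr //.
rewrite -signr_odd l_odd; congr (_ * _).
rewrite !chi_neg1_intr; congr (_%:~R).
have eta2 := eta_sqr1 w l0.
have eta0 : chi w (-1 : int) l%:R != 0 by rewrite -sqrf_eq0 eta2.
by apply: (mulfI eta0); rewrite chi_mulV ?neg1_expr // -expr2 eta2.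
Qed.

(** In characteristic [l] take [z] with [z^4 = -1] and [t = z + z^-1].  Then
    [t^2 = 2], and [t^l = z^l + z^-l] is [t] or [- t] according to [l] modulo
    8. *)
Lemma two_euler : (2%:R : 'F_l) ^+ l./2 = (-1) ^+ (l %% 8 \in [:: 3; 5])%N.
Proof.
have [K [f]] := closed_field_over_Fp l.
have charK : l \in [pchar K] by rewrite (fmorph_pchar f) pchar_Fp.
have [z z4] := @closed_exprn_root K 4 (-1) isT.
have z0 : z != 0.
  by apply: contra_eq_neq z4 => ->; rewrite expr0n eq_sym oppr_eq0 oner_eq0.
pose t := z + z^-1.
have z8 : z ^+ 8 = 1 by rewrite -[8%N]/(4 * 2)%N exprM z4 sqrrN expr1n.
have t2 : t ^+ 2 = 2%:R.
  transitivity ((z ^+ 4 + 1) / z ^+ 2 + 2%:R); first by rewrite /t; field.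
  by rewrite z4 addNr mul0r add0r.
have t0 : t != 0.
  apply: contraNneq Fp_two_neq0 => e; rewrite -(fmorph_eq0 f) rmorph_nat -t2 e.
  by rewrite expr0n.
apply: (fmorph_inj f); rewrite rmorphXn rmorph_sign rmorph_nat.
apply: (mulIf t0); rewrite -t2 -exprM mulnC -exprSr -l_half.
have -> : t ^+ l = z ^+ (l %% 8) + (z ^+ (l %% 8))^-1.
  rewrite -(pFrobenius_autE charK) rmorphD /= !pFrobenius_autE exprVn.
  by rewrite expr_mod.
have : (l %% 8 \in [:: 1; 3; 5; 7])%N by rewrite !inE; move: l_odd; clear; lia.
have z7 : z ^+ 7 = z^-1 by apply: (mulIf z0); rewrite -exprSr z8 mulVf.
have z5 : z ^+ 5 = - z by rewrite exprSr z4 mulN1r.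
have z3 : z ^+ 3 = - z^-1 by apply: (mulIf z0); rewrite -exprSr z4 mulNr mulVf.
by rewrite !inE => /or4P[]/eqP->; rewrite /= ?expr1 ?expr0 ?mul1r ?mulN1r ?z7 ?z5 ?z3
  /t ?invrN ?invrK ?opprD // addrC.
Qed.

(** The associate of [l] that is 1 modulo 4; a product of such numbers is again
    1 modulo 4, which is how the sign of [D] enters. *)
Definition prime_star : int := if (l %% 4 == 1)%N then l%:Z else - l%:Z.

(** In characteristic [l] the hypotheses say [S(-1) = 0] and
    [p^((l-1)/2) = 1], so [G^4 = - p^2] makes [G^(l-1)], for [l] equal to 1
    modulo 4, or [G^(l+1)] divided by [p], for [l] equal to 3 modulo 4, a power
    of [-1].  The Frobenius identifies that quantity with the quartic character
    of [l], respectively of [- l]. *)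
Lemma quartic_char_prime x : (l %| jacobsthal w (-1)%R)%Z -> p = x ^ 2 %[mod l] ->
  (prime_star%:~R : 'F_p) ^+ (#|'F_p|.-1 %/ 4) = (-1) ^+ (l %% 8 \in [:: 3; 5])%N.
Proof.
move=> dvd_S def_p.
have [K [f]] := closed_field_over_Fp l.
have charK : l \in [pchar K] by rewrite (fmorph_pchar f) pchar_Fp.
have pK : (p%:R : K) != 0 by rewrite -(rmorph_nat f) fmorph_eq0 p0.
have twoK : (2%:R : K) != 0 by rewrite -(rmorph_nat f) fmorph_eq0 Fp_two_neq0.
have [psi [psiD psi_sum0 psi0]] := additive_character p_pr pK.
have [iota iota2] := @closed_exprn_root K 2 (-1) isT.
have S0 : (jacobsthal w (-1))%:~R = 0 :> K.
  have /dvdzP[k ->] := dvd_S.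
  by rewrite rmorphM /= -[l%:~R]/(l%:R) (pcharf0 charK) mulr0.
have qK : (#|'F_p|%:R : K) != 0 by rewrite card_Fp.
have G4 := quartic_gauss_expr4 w_prim dvd4n psiD psi_sum0 psi0 iota2 qK twoK S0.
have GG' := quartic_gauss_inv w_prim dvd4n psiD psi_sum0 psi0 iota2 twoK.
have in_p := iota_exprn dvd4n iota2; have Nin_p := neg_iota_exprn dvd4n iota2.
rewrite card_Fp // in G4 GG'; set G := gauss _ _ _ in G4 GG'.
set G' := gauss _ _ _ in GG'.
have G0 : G != 0.
  by apply: contraNneq pK => e; move/eqP: G4; rewrite e expr0n eq_sym oppr_eq0 expf_eq0.
have p_euler : (p%:R : K) ^+ l./2 = 1.
  have def_pK : (p%:R : K) = x%:R ^+ 2.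
    rewrite -!(rmorph_nat f) -rmorphXn -natrX; congr (f _).
    by rewrite -Fp_nat_mod // def_p Fp_nat_mod.
  rewrite def_pK -exprM mulnC.
  have xK : (x%:R : K) != 0.
    by apply: contraNneq pK => e; rewrite def_pK e expr0n.
  apply: (mulIf xK); rewrite -exprSr -l_half mul1r.
  by rewrite -(pFrobenius_autE charK) rmorph_nat.
have frob := gauss_frobenius w_prim psiD psi0 charK in_p l0.
apply: (chi_quartic w_prim dvd4n (neg1_neq1K twoK) iota2).
  by rewrite /prime_star; case: ifP => _; rewrite ?rmorphN ?oppr_eq0.
have p2 : (p%:R : K) ^+ 2 ^+ l./2 = 1 by rewrite exprAC p_euler expr1n.
rewrite /prime_star; case: ifP => l4.
  have iota_l : iota ^+ l = iota.
    rewrite (_ : l = (4 * (l %/ 4)).+1); last by move: l4; clear; lia.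
    by rewrite exprSr exprM -[4%N]/(2 * 2)%N exprM iota2 sqrrN !expr1n mul1r.
  rewrite iota_l -/G in frob.
  have half : l./2 = (2 * (l %/ 4))%N by move: l4; clear; lia.
  have chi_linv : chi w iota l%:R^-1 = (-1) ^+ (l %/ 4).
    apply: (mulIf G0); rewrite -frob {1}(_ : l = (4 * (l %/ 4)).+1); last by move: l4; clear; lia.
    by rewrite exprSr exprM G4 (exprNn (p%:R ^+ 2)) -exprM -half p_euler mulr1.
  have := chi_mulV w_prim in_p l0; rewrite chi_linv mulrC => /(canRL (signrMK _)) ->.
  rewrite mulr1; apply/eqP; rewrite signr_eq ?(neg1_neq1K twoK) //.
  by rewrite !inE; move: l4 l_odd; clear; lia.
have iota_l : iota ^+ l = - iota.
  rewrite (_ : l = (2 * (2 * (l %/ 4) + 1)).+1); last by move: l4 l_odd; clear; lia.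
  by rewrite exprSr exprM iota2 exprD exprM sqrrN !expr1n mul1r expr1 mulN1r.
have half : l./2.+1 = (2 * (l.+1 %/ 4))%N by move: l4 l_odd; clear; lia.
have pow_succ : G ^+ l.+1 = (-1) ^+ (l.+1 %/ 4) * p%:R.
  rewrite (_ : l.+1 = (4 * (l.+1 %/ 4))%N); last by move: l4 l_odd; clear; lia.
  by rewrite exprM G4 (exprNn (p%:R ^+ 2)) -exprM mulKn // -half exprSr p_euler mul1r.
have chi_l : chi w (- iota) l%:R^-1 = chi w iota l%:R.
  have mix t : t != 0 -> chi w (- iota) t * chi w iota t = 1.
    by move=> /negPf t0; rewrite /chi t0 -exprMn mulNr -expr2 iota2 opprK expr1n.
  have := chi_mulV w_prim Nin_p l0; rewrite -(mix _ l0); apply: mulfI.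
  by apply: contra_eq_neq (mix _ l0) => ->; rewrite mul0r eq_sym oner_eq0.
rewrite iota_l -/G -/G' chi_l in frob.
have chi_Nl : chi w iota (- l%:R) = (-1) ^+ (l.+1 %/ 4).
  apply: (mulIf pK); transitivity (chi w iota l%:R * (chi w iota (-1) * p%:R)).
    by rewrite -mulN1r (chiM w_prim (-1)) // mulrAC mulrC mulrA.
  by rewrite -GG' [G * G']mulrC mulrA -frob -exprSr pow_succ.
rewrite rmorphN /= -[(l%:Z)%:~R]/(l%:R) chi_Nl; apply/eqP.
rewrite signr_eq ?(neg1_neq1K twoK) // !inE; move: l4 l_odd; clear; lia.
Qed.

End QuadraticReciprocity.

(** * The quartic character of 2 *)

(** For odd [m] this is the Jacobi symbol of 2 over [m]. *)
Definition two_sign (m : nat) : int := (-1) ^+ (m %% 8 \in [:: 3; 5])%N.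

Lemma two_signM a b : odd a -> odd b -> two_sign (a * b) = two_sign a * two_sign b.
Proof.
move=> a_odd b_odd; rewrite /two_sign -modnMm.
have mod8 c : odd c -> (c %% 8 \in [:: 1; 3; 5; 7])%N by rewrite !inE; clear; lia.
have := mod8 a a_odd; have := mod8 b b_odd; rewrite !inE.
by move=> /or4P[]/eqP-> /or4P[]/eqP->.
Qed.

Section TwoIsQuartic.

Variables (p : nat) (w : 'F_p) (alpha : int) (z : nat).
Hypotheses (p_pr : prime p) (w_prim : (#|'F_p|.-1).-primitive_root w).
Hypotheses (alpha1 : (alpha = 1 %[mod 4])%Z) (def_p : p%:Z = alpha ^+ 2 + 16 * z%:Z ^+ 2).

Notation eta := (chi w (-1 : int)).

Let def_p' : p%:Z = alpha ^+ 2 + 4 * (2 * z)%N%:Z ^+ 2.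
Proof. by rewrite def_p PoszM; ring. Qed.

Let dvd4 : (4 %| #|'F_p|.-1)%N := dvd4_two_squares p_pr alpha1 def_p'.

Let p_gt2 : (2 < p)%N.
Proof. by have := prime_gt1 p_pr; have := dvd4; rewrite card_Fp //; clear; lia. Qed.

(** Both sides are multiplicative.  This replaces the reciprocity law for Jacobi
    symbols: it is enough to look at the prime divisors of [m]. *)
Lemma eta_of_prime_divisors (f : nat -> int) m :
    f 1%N = 1 -> (forall a b, odd a -> odd b -> f (a * b)%N = f a * f b) ->
    odd m -> (forall l, prime l -> l %| m -> eta l%:R = f l)%N ->
  eta m%:R = f m.
Proof.
move=> f1 fM; elim/ltn_ind: m => m IHm m_odd eta_f.
have [m1|m_neq1] := eqVneq m 1%N; first by rewrite m1 f1 chi1 ?neg1_expr.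
have m_gt1 : (1 < m)%N by case: m m_odd m_neq1 {IHm eta_f} => [|[]].
have pr := pdiv_prime m_gt1; have dvd := pdiv_dvd m.
have def_m : m = (pdiv m * (m %/ pdiv m))%N by rewrite mulnC divnK.
have /andP[d_odd q_odd] : odd (pdiv m) && odd (m %/ pdiv m) by rewrite -oddM -def_m.
rewrite def_m natrM etaM // fM // eta_f // IHm //.
  by rewrite ltn_Pdiv ?prime_gt1 // ltnW.
by move=> l l_pr l_dvd; apply: eta_f => //; rewrite def_m dvdn_mull.
Qed.

Lemma eta_absz (c : int) : eta `|c|%N%:R = eta c%:~R.
Proof. by case: (intP c) => // k; rewrite ?absz0 // abszN rmorphN /= etaN. Qed.

(** Modulo [l], [p] is [2^d] times a nonzero square, so quadratic reciprocity
    gives the [d]-th power of the character of 2 modulo [l].  It is used with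
    [d = 0] for the divisors of [alpha] and with [d = 1] for those of
    [alpha + 4 z].  The bound on [c] ensures [l != p]. *)
Lemma eta_prime_divisor (c : int) (d : nat) l :
    prime l -> (l %| c)%Z -> ~~ (2 %| c)%Z -> c != 0 -> c ^+ 2 <= 2 * p%:Z ->
    (l %| p%:Z - 2 ^+ d * (4 * z%:Z) ^+ 2)%Z ->
  eta l%:R = two_sign l ^+ d.
Proof.
move=> l_pr l_dvd c_odd c0 le_c def_pl.
have l_odd : odd l.
  by apply: contraNT c_odd => /(prime_oddPn l_pr) l2; rewrite -[2]/(2%N%:Z) -l2.
have neq_lp : l != p.
  by apply: contraNneq (small_sqr_ndvd p_gt2 c0 le_c) => <-.
have pF : (p%:R : 'F_l) = 2%:R ^+ d * (4 * z)%N%:R ^+ 2.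
  apply/eqP; rewrite -subr_eq0; move/dvdzP: def_pl => [k def_k].
  have -> : p%:R - 2%:R ^+ d * (4 * z)%N%:R ^+ 2
      = (p%:Z - 2 ^+ d * (4 * z%:Z) ^+ 2)%:~R :> 'F_l.
    by rewrite rmorphB rmorphM !rmorphXn /= -PoszM.
  by rewrite def_k rmorphM /= -[l%:~R]/(l%:R) pchar_Fp_0 // mulr0.
have p0 : (p%:R : 'F_l) != 0 by apply: Fp_prime_neq0; rewrite // eq_sym.
have N1 : (-1 : 'F_l) != 1.
  by apply: (neg1_neq1K (Fp_two_neq0 l_pr l_odd)).
have := quadratic_reciprocity p_pr l_pr l_odd neq_lp w_prim dvd4.
have zF : ((4 * z)%N%:R : 'F_l) != 0.
  by apply: contraNneq p0 => e; rewrite pF e expr0n mulr0.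
rewrite pF exprMn exprAC two_euler // -[_ ^+ 2 ^+ _]exprM.
have -> : (2 * l./2)%N = #|'F_l|.-1.
  by rewrite card_Fp // mul2n -[in RHS](odd_double_half l) l_odd.
rewrite finField_expr1 // mulr1 /two_sign -!exprM; case: etaP => // [_|c' _ _|c' _ _] /eqP;
 rewrite ?rmorphN1 ?rmorph1 ?rmorph0 /=.
- by rewrite eq_sym signr_eq0.
- by rewrite eq_sym -(expr0 (-1)) signr_eq // => /eqP odd_e; rewrite -signr_odd odd_e.
- by rewrite eq_sym -[X in _ == X](expr1 (-1)) signr_eq // => /eqP odd_e; rewrite -signr_odd odd_e.
Qed.

(** Put [b = 4 z] and [c = alpha + b].  In the field, [alpha^2 + b^2 = 0], so
    [b = j alpha] with [j^2 = -1] and [c^2 = 2 j alpha^2].  Raised to the power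
    [m = (p - 1)/4] this reads [eta(c) = 2^m j^m eta(alpha)], where
    [eta(alpha) = 1], [eta(c)] is the Jacobi symbol of 2 over [c], and
    [j^m = (-1)^(m/2)] because [m] is even. *)
Lemma two_quartic : (2%:R : 'F_p) ^+ (#|'F_p|.-1 %/ 4) = (-1) ^+ z.
Proof.
have [k def_a] := eq1_mod4_rep alpha1; have alpha_odd := eq1_mod4_odd alpha1.
set m := (_ %/ 4)%N; pose b : int := 4 * z%:Z; pose c := alpha + b.
have def_pb : p%:Z = alpha ^+ 2 + b ^+ 2 by rewrite def_p /b; ring.
have alpha0 : alpha != 0 by apply: contraNneq alpha_odd => ->.
have c_odd : ~~ (2 %| c)%Z by rewrite /c /b; move: alpha_odd; clear; lia.
have c0 : c != 0 by apply: contraNneq c_odd => ->.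
have p_ge0 : 0 <= p%:Z by [].
have le_alpha : alpha ^+ 2 <= 2 * p%:Z.
  by rewrite (_ : 2 * p%:Z = p%:Z + p%:Z) ?ler_wpDr //; [rewrite def_pb lerDl sqr_ge0 | ring].
have le_c : c ^+ 2 <= 2 * p%:Z.
  rewrite (_ : 2 * p%:Z = c ^+ 2 + (alpha - b) ^+ 2) ?lerDl ?sqr_ge0 //.
  by rewrite def_pb /c; ring.
have odd_absz (u : int) : ~~ (2 %| u)%Z -> odd `|u|%N by clear; lia.
have eta_alpha : eta alpha%:~R = 1.
  rewrite -eta_absz; apply: (eta_of_prime_divisors (f := fun=> 1)) => //.
    exact: odd_absz.
  move=> l l_pr l_dvd; rewrite -[RHS](expr0 (two_sign l)).
  apply: eta_prime_divisor alpha_odd alpha0 le_alpha _ => //.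
  rewrite def_p; apply: dvdz_trans (_ : alpha %| _)%Z => //.
  by apply/dvdzP; exists alpha; ring.
have eta_c : eta c%:~R = two_sign `|c|%N.
  rewrite -eta_absz; apply: eta_of_prime_divisors => //; first exact: two_signM.
    exact: odd_absz.
  move=> l l_pr l_dvd; rewrite -[RHS]expr1.
  apply: eta_prime_divisor c_odd c0 le_c _ => //.
  rewrite def_pb; apply: dvdz_trans (_ : c %| _)%Z => //.
  by apply/dvdzP; exists (alpha - b); rewrite /c /b; ring.
have alphaF : (alpha%:~R : 'F_p) != 0.
  by apply/eqP => e; move: eta_alpha; rewrite e chi0.
pose j := b%:~R / alpha%:~R : 'F_p.
have def_b : b%:~R = j * alpha%:~R by rewrite divfK.
have j2 : j ^+ 2 = -1.
  have /eqP : (p%:Z)%:~R = 0 :> 'F_p by exact: pchar_Fp_0.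
  rewrite def_pb rmorphD !rmorphXn /= def_b exprMn.
  rewrite -[X in X + _]mul1r -mulrDl mulf_eq0 expf_eq0 (negPf alphaF) orbF.
  by rewrite addrC addr_eq0 => /eqP.
have c2 : c%:~R ^+ 2 = 2%:R * (j * alpha%:~R ^+ 2) :> 'F_p.
  rewrite /c rmorphD /= def_b.
  transitivity (alpha%:~R ^+ 2 * (1 + j ^+ 2) + 2%:R * (j * alpha%:~R ^+ 2) : 'F_p); first by ring.
  by rewrite j2 subrr mulr0 add0r.
(* [m = (p - 1)/4], and [alpha = 1 + 4 k] gives [p = 1 + 8 (k + 2 v)]. *)
have [v def_m] : exists v : int, m%:Z = 2 * (k + 2 * v).
  exists (k ^+ 2 + z%:Z ^+ 2).
  have : p%:Z = 1 + 8 * (k + 2 * (k ^+ 2 + z%:Z ^+ 2)) by rewrite def_p def_a; ring.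
  by rewrite /m card_Fp //; move: (k + _) (prime_gt0 p_pr); clear; lia.
have m_even : m = (2 * (m %/ 2))%N by move: def_m; clear; lia.
have := eta_expr c%:~R w_prim dvd4; rewrite -/m mulnC exprM c2 exprMn.
rewrite exprMn -exprM [(2 * m)%N]mulnC -(eta_expr _ w_prim) // eta_alpha mulr1.
rewrite {2}m_even exprM j2 eta_c /two_sign rmorph_sign mulrC => /esym/(canRL (signrMK _)) ->.
rewrite -exprD; apply/eqP; rewrite signr_eq ?(neg1_neq1 w_prim) // oddD /c def_a /b !inE.
by move: def_m; clear; lia.
Qed.

End TwoIsQuartic.

(** * The trace of Frobenius of y^2 = x^3 + D x *)

(** Above [x] there are [1 + eta (x^3 + D x)] points. *)
Lemma a_p_jacobsthal (D : int) (p : nat) (w : 'F_p) : prime p ->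
    (#|'F_p|.-1).-primitive_root w -> (4 %| #|'F_p|.-1)%N ->
  a_p D p = - jacobsthal w D%:~R.
Proof.
move=> p_pr w_prim dvd4.
suff card_E : #|E_affine_points D p|%:Z = p%:Z + jacobsthal w D%:~R.
  by rewrite /a_p /E_card -addn1 PoszD card_E; ring.
transitivity (#|'F_p|%:Z + jacobsthal w D%:~R); last by rewrite card_Fp.
rewrite -[#|'F_p|%:Z]natz -[in RHS]sum1_card natr_sum -big_split /=.
rewrite -[#|E_affine_points _ _|%:Z]natz -sum1_card natr_sum (partition_big fst predT) //=.
apply: eq_bigr => x _; rewrite -card_sqrt // -natr_sum sum1_card natz; congr Posz.
have pair_inj : injective (pair x : 'F_p -> 'F_p * 'F_p) by move=> ? ? [].
rewrite -(card_imset _ pair_inj).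
apply: eq_card => -[x' y]; apply/andP/imsetP => [[]|[y' + [-> ->]]].
  by rewrite inE /= => e /eqP def_x; exists y; rewrite ?def_x // inE -def_x.
by rewrite !inE /= => ->.
Qed.

Definition star_prod (s : seq nat) : int := \prod_(l <- s) prime_star l.

(** Replacing each prime by its associate that is 1 modulo 4 costs only a
    sign. *)
Lemma star_prod_sign (s : seq nat) : all (fun l => prime l && odd l) s ->
  exists2 b : nat, (\prod_(l <- s) l)%N%:Z = (-1) ^+ b * star_prod s
    & (star_prod s = 1 %[mod 4])%Z.
Proof.
rewrite /star_prod; elim: s => [|l s IHs] /=; first by exists 0%N; rewrite !big_nil.
case/andP=> /andP[_ l_odd] /IHs[b def_s s1]; rewrite !big_cons PoszM def_s.
have l1 : (prime_star l = 1 %[mod 4])%Z.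
  by rewrite /prime_star; case: ifP l_odd; clear; lia.
exists (b + (l %% 4 != 1))%N.
  by rewrite exprD /prime_star; case: eqP => _ /=; rewrite ?expr0 ?expr1; ring.
by rewrite -modzMm l1 s1.
Qed.

Definition count_3_5 (s : seq nat) := (count_mod8 3 s + count_mod8 5 s)%N.

Lemma count_3_5_cons l s : count_3_5 (l :: s) = ((l %% 8 \in [:: 3; 5]) + count_3_5 s)%N.
Proof. by rewrite /count_3_5 /count_mod8 /= !inE; case: eqP => [->|_] /=; lia. Qed.

(** Writing the odd part of [D] as a sign times a number that is 1 modulo 4
    makes the residue of [D] modulo 4 visible in the sign, while the other
    factor has a quartic character that depends on [e] alone. *)
Lemma D_decomposition D neg sigma ps qs ls : D_factorization D neg sigma ps qs ls ->
  let M := star_prod ps * star_prod qs ^+ 2 * star_prod ls ^+ 3 in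
  (exists b : nat, D = (-1) ^+ b * 2 ^+ sigma * M) /\ (M = 1 %[mod 4])%Z.
Proof.
case=> _ _; rewrite !all_cat => /and3P[hp hq hl] def_D M.
have [bp Ep p1] := star_prod_sign hp; have [bq Eq q1] := star_prod_sign hq.
have [bl El l1] := star_prod_sign hl; split.
  exists (neg + bp + bl)%N; rewrite def_D -natz !natrM !natrX !natz Ep Eq El /M.
  transitivity ((-1) ^+ neg * (-1) ^+ bp * (-1) ^+ bl * 2 ^+ sigma * M
    * ((-1) ^+ bq ^+ 2) * ((-1) ^+ bl ^+ 2)).
    by rewrite /M; ring.
  by rewrite !sqrr_sign !mulr1 !exprD.
have mul1 u v : (u = 1 %[mod 4])%Z -> (v = 1 %[mod 4])%Z -> (u * v = 1 %[mod 4])%Z.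
  by move=> u1 v1; rewrite -modzMm u1 v1.
exact: mul1 _ _ (mul1 _ _ p1 (mul1 _ _ q1 q1)) (mul1 _ _ l1 (mul1 _ _ l1 l1)).
Qed.

Section TraceForD.

Variables (p : nat) (alpha : int) (y : nat).
Hypotheses (p_pr : prime p) (alpha1 : (alpha = 1 %[mod 4])%Z).
Hypothesis (def_p : p%:Z = alpha ^+ 2 + 4 * y%:Z ^+ 2).

Notation m := (#|'F_p|.-1 %/ 4)%N.

Let dvd4 : (4 %| #|'F_p|.-1)%N := dvd4_two_squares p_pr alpha1 def_p.

Let N1 : (-1 : 'F_p) != 1.
Proof. by have [w w_prim] := finField_prim_root 'F_p; apply: neg1_neq1 w_prim dvd4. Qed.

Lemma neg1_quartic : (-1 : 'F_p) ^+ m = (-1) ^+ y.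
Proof.
have [k def_a] := eq1_mod4_rep alpha1; apply/eqP; rewrite signr_eq //.
have : p%:Z = 1 + 4 * (2 * (k + 2 * k ^+ 2) + y%:Z ^+ 2) by rewrite def_p def_a; ring.
have -> : odd y = odd (y ^ 2) by rewrite oddX.
have -> : y%:Z ^+ 2 = (y ^ 2)%N%:Z by rewrite -[RHS]natz natrX natz.
rewrite card_Fp //; by move: (k + _) (y ^ 2)%N (prime_gt0 p_pr); clear; lia.
Qed.

(** [2 = - j (1 + j)^2] for a square root [j] of [-1], so the quadratic
    character of 2 is that of [j], which is the quartic character of [-1]. *)
Lemma two_quadratic : (2%:R : 'F_p) ^+ (m * 2) = (-1) ^+ y.
Proof.
have [w w_prim] := finField_prim_root 'F_p.
have j2 := prim_quarter_sqr w_prim dvd4; set j := w ^+ _ in j2.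
have j1 : 1 + j != 0.
  apply: contraNneq N1 => /eqP; rewrite addrC addr_eq0 => /eqP e.
  by rewrite -j2 e sqrrN expr1n.
have -> : 2%:R = - j * (1 + j) ^+ 2.
  by transitivity (2%:R * - (j ^+ 2) - j * (1 + j ^+ 2)); [rewrite j2; ring | ring].
have -> : (- j * (1 + j) ^+ 2) ^+ (m * 2) = (- j) ^+ 2 ^+ m * (1 + j) ^+ #|'F_p|.-1.
  rewrite exprMn -!exprM [(2 * m)%N]mulnC; congr (_ * _ ^+ _).
  by move: dvd4; clear; lia.
by rewrite finField_expr1 // mulr1 sqrrN j2 neg1_quartic.
Qed.

Lemma alpha_prime_divisor l : prime l -> (l %| alpha)%Z -> l != p.
Proof.
move=> l_pr l_dvd; apply: contraTneq l_dvd => ->.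
apply: small_sqr_ndvd.
- by have := prime_gt1 p_pr; have := dvd4; rewrite card_Fp //; clear; lia.
- by apply: contraNneq (eq1_mod4_odd alpha1) => ->.
rewrite (_ : 2 * p%:Z = alpha ^+ 2 + (alpha ^+ 2 + 8 * y%:Z ^+ 2)).
  by rewrite lerDl addr_ge0 ?sqr_ge0 // mulr_ge0 ?sqr_ge0.
by rewrite def_p; ring.
Qed.

(** [l] divides [S(-1) = - 2 alpha (-1)^y], and [p] is [(2 y)^2] modulo [l]. *)
Lemma star_quartic l : prime l -> odd l -> (l %| alpha)%Z ->
  ((prime_star l)%:~R : 'F_p) ^+ m = (-1) ^+ (l %% 8 \in [:: 3; 5])%N.
Proof.
move=> l_pr l_odd l_dvd; have neq_lp := alpha_prime_divisor l_pr l_dvd.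
have [w w_prim] := finField_prim_root 'F_p.
apply: (quartic_char_prime p_pr l_pr l_odd neq_lp w_prim dvd4 (x := 2 * y)).
  rewrite (jacobsthal_neg1 p_pr w_prim alpha1 def_p) rpredN.
  by rewrite dvdz_mulr // dvdz_mull.
apply/eqP; rewrite -eqz_nat -!modz_nat -/(_ == _ %[mod _])%Z eqz_mod_dvd def_p.
have -> : ((2 * y) ^ 2)%N%:Z = 4 * y%:Z ^+ 2 by rewrite -natz natrX natrM !natz; ring.
by rewrite addrK exprS dvdz_mulr.
Qed.

Lemma star_prod_quartic s : all (fun l => [&& prime l, odd l & (l %| alpha)%Z]) s ->
  ((star_prod s)%:~R : 'F_p) ^+ m = (-1) ^+ count_3_5 s.
Proof.
rewrite /star_prod; elim: s => [|l s IHs] /=; first by rewrite big_nil expr1n.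
case/andP=> /and3P[l_pr l_odd l_dvd] /IHs{}IHs.
by rewrite big_cons rmorphM exprMn star_quartic // IHs -exprD count_3_5_cons.
Qed.

Variables (D : int) (neg : bool) (sigma : nat) (ps qs ls : seq nat).
Hypothesis hD : D_factorization D neg sigma ps qs ls.
Hypothesis hdvd : forall l : nat, prime l -> odd l -> (l %| D)%Z -> (l %| alpha)%Z.
Let e := (count_3_5 ps + count_3_5 ls)%N.
Let M := star_prod ps * star_prod qs ^+ 2 * star_prod ls ^+ 3.
Variable b : nat.
Hypothesis def_D : D = (-1) ^+ b * 2 ^+ sigma * M.

Lemma star_part_quartic : (M%:~R : 'F_p) ^+ m = (-1) ^+ e.
Proof.
case: hD => _ _ odd_primes abs_D.
have dvd_D l : l \in ps ++ qs ++ ls -> (l %| D)%Z.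
  rewrite !mem_cat => l_in; rewrite dvdzE abs_D abszMsign /=.
  have /or3P[] := l_in => {}l_in.
  - by rewrite -!mulnA dvdn_mull // dvdn_mulr // (big_rem l) //= dvdn_mulr.
  - by rewrite -mulnA dvdn_mull // dvdn_mulr // dvdn_exp // (big_rem l) //= dvdn_mulr.
  by rewrite dvdn_mull // dvdn_exp // (big_rem l) //= dvdn_mulr.
have all_dvd s : {subset s <= ps ++ qs ++ ls} ->
    all (fun l => [&& prime l, odd l & (l %| alpha)%Z]) s.
  move=> sub; apply/allP => l /sub l_in; have /andP[l_pr l_odd] := allP odd_primes l l_in.
  by rewrite l_pr l_odd hdvd // dvd_D.
have /star_prod_quartic chi_ps : all (fun l => [&& prime l, odd l & (l %| alpha)%Z]) ps.
  by apply: all_dvd => l l_in; rewrite !mem_cat l_in.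
have /star_prod_quartic chi_qs : all (fun l => [&& prime l, odd l & (l %| alpha)%Z]) qs.
  by apply: all_dvd => l l_in; rewrite !mem_cat l_in orbT.
have /star_prod_quartic chi_ls : all (fun l => [&& prime l, odd l & (l %| alpha)%Z]) ls.
  by apply: all_dvd => l l_in; rewrite !mem_cat l_in !orbT.
rewrite /M !rmorphM /= !exprMn chi_ps chi_qs chi_ls -!exprD; apply/eqP.
rewrite signr_eq // /e; move: (count_3_5 ps) (count_3_5 qs) (count_3_5 ls) => cp cq cl.
by rewrite !oddD; case: (odd cp); case: (odd cq); case: (odd cl).
Qed.

Lemma ND_quartic : (- D%:~R : 'F_p) ^+ m
  = (-1) ^+ (y * b.+1) * (2%:R ^+ m) ^+ sigma * (-1) ^+ e.
Proof.
have -> : - D%:~R = (-1) ^+ b.+1 * 2%:R ^+ sigma * M%:~R :> 'F_p.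
  rewrite def_D; move: M => M'; rewrite 2!rmorphM /= !rmorphXn /= exprS; ring.
rewrite !exprMn star_part_quartic [(-1) ^+ b.+1 ^+ m]exprAC neg1_quartic.
by rewrite [2%:R ^+ sigma ^+ m]exprAC [in RHS]exprM.
Qed.

Lemma a_p_sigma_even h : sigma = (2 * h)%N ->
  a_p D p = 2 * alpha * (-1) ^+ (e + y * (b + h)).
Proof.
move=> def_sigma; have [w w_prim] := finField_prim_root 'F_p.
rewrite (a_p_jacobsthal _ _ w_prim) //.
rewrite (@jacobsthal_quartic _ _ _ _ p_pr w_prim alpha1 def_p _ (y * b.+1 + y * h + e)).
  rewrite opprK; congr (_ * _); apply/eqP; move: e => c; rewrite signr_eq //.
  by rewrite !(oddD, oddM) /=; case: (odd c); case: (odd y); case: (odd b); case: (odd h).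
rewrite ND_quartic def_sigma [2%:R ^+ m ^+ (2 * h)]exprM -(exprM 2%:R) two_quadratic.
by rewrite -(exprM _ y h) -!exprD.
Qed.

(** Here 2 is not a square modulo [p], hence neither is [- D], and half the
    trace is [2 y] up to sign, which is even, whereas [alpha] is odd. *)
Lemma a_p_sigma_odd_y_odd : odd sigma -> odd y -> a_p D p ^+ 2 != (2 * alpha) ^+ 2.
Proof.
move=> sigma_odd y_odd; have [w w_prim] := finField_prim_root 'F_p.
rewrite (a_p_jacobsthal _ _ w_prim) // sqrrN.
rewrite (jacobsthal_nonsquare p_pr w_prim alpha1 def_p); last first.
  rewrite exprM ND_quartic !exprMn !sqrr_sign mul1r mulr1 [2%:R ^+ m ^+ sigma ^+ 2]exprAC -(exprM 2%:R) two_quadratic.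
  by rewrite -exprM -signr_odd oddM y_odd sigma_odd.
have [k ->] := eq1_mod4_rep alpha1; apply/eqP.
by move: (y%:Z ^+ 2); clear; lia.
Qed.

Lemma a_p_sigma_odd_y_even z : odd sigma -> y = (2 * z)%N ->
  a_p D p = 2 * alpha * (-1) ^+ (e + z).
Proof.
move=> sigma_odd def_y; have [w w_prim] := finField_prim_root 'F_p.
rewrite (a_p_jacobsthal _ _ w_prim) //.
have def_p16 : p%:Z = alpha ^+ 2 + 16 * z%:Z ^+ 2.
  by rewrite def_p def_y PoszM; ring.
rewrite (@jacobsthal_quartic _ _ _ _ p_pr w_prim alpha1 def_p _ (y * b.+1 + z * sigma + e)).
  rewrite opprK; congr (_ * _); apply/eqP; move: e => c; rewrite signr_eq // def_y.
  by rewrite !(oddD, oddM) /= sigma_odd; case: (odd z); case: (odd c).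
by rewrite ND_quartic (two_quartic p_pr w_prim alpha1 def_p16) -exprM -!exprD.
Qed.

End TraceForD.

(** * Relative densities *)

Section RelativeDensity.

Variable R : realType.

Definition count_below (A : pred nat) (n : nat) : nat := (\sum_(p < n) A p)%N.

Lemma card_count_below (A : pred nat) n : #|[set p : 'I_n | A p]| = count_below A n.
Proof.
rewrite /count_below -sum1_card big_mkcond /=; apply: eq_bigr => p _.
by rewrite inE; case: (A p).
Qed.

(** The order of growth of the number of primes below [n] represented by a
    quadratic polynomial. *)
Definition HL_scale (n : nat) : R := Num.sqrt n%:R / ln n%:R.

(** Densities are measured on the scale of the conjecture and not relative to a
    set of primes, so that they are additive and insensitive to finitely many
    primes; [has_HL_density_ratio] converts them back to proportions. *)
Definition has_HL_density (A : pred nat) (d : R) : Prop :=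
  ((fun n => (count_below A n)%:R / HL_scale n) @ \oo --> d)%classic.

Lemma cvg_near_eq (u v : nat -> R) (l : R) : (\forall n \near \oo, u n = v n)%classic ->
  (u @ \oo --> l -> v @ \oo --> l)%classic.
Proof. by move=> eq_uv; apply: cvg_trans; apply: near_eq_cvg eq_uv. Qed.

Lemma HL_scale_gt0 n : (1 < n)%N -> 0 < HL_scale n.
Proof.
by move=> n_gt1; rewrite divr_gt0 ?sqrtr_gt0 ?ln_gt0 ?ltr0n ?ltr1n // ltnW.
Qed.

(** With [r] the fourth root of [n], [ln n = 4 ln r < 4 r], whence
    [ln n / sqrt n < 4 / r]. *)
Lemma HL_scaleV_cvg0 : ((fun n => (HL_scale n)^-1) @ \oo --> (0 : R))%classic.
Proof.
have sqrt2_cvg : ((fun n => 4 * Num.sqrt (Num.sqrt (n%:R^-1 : R))) @ \oo --> (0 : R))%classic.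
  rewrite -(mulr0 4) -[X in 4 * X](sqrtr0 R) -[X in Num.sqrt X](sqrtr0 R).
  apply: cvgM; first exact: cvg_cst.
  apply: (@continuous_cvg _ _ _ _ _ _ Num.sqrt); first exact: sqrt_continuous.
  apply: (@continuous_cvg _ _ _ _ _ _ Num.sqrt); first exact: sqrt_continuous.
  by rewrite -(cvg_shiftS (fun n => n%:R^-1 : R)); exact: cvg_harmonic.
apply: (squeeze_cvgr _ (cvg_cst (0 : R)) sqrt2_cvg).
near=> n; have n_gt1 : (1 < n)%N by near: n; exists 2%N.
rewrite invr_ge0 ltW ?HL_scale_gt0 //=.
have n_gt0 : (0 : R) < n%:R by rewrite ltr0n ltnW.
rewrite /HL_scale invf_div !sqrtrV ?sqrtr_ge0 ?ltW //.
set r := Num.sqrt (Num.sqrt n%:R); have r_gt0 : 0 < r by rewrite !sqrtr_gt0.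
have r2 : Num.sqrt n%:R = r ^+ 2 by rewrite sqr_sqrtr ?sqrtr_ge0.
have -> : (n%:R : R) = r ^+ 4 by rewrite -[4%N]/(2 * 2)%N exprM -r2 sqr_sqrtr ?ltW.
have -> : Num.sqrt (r ^+ 4) = r ^+ 2.
  by rewrite -[4%N]/(2 * 2)%N exprM sqrtr_sqr ger0_norm // exprn_ge0 ?ltW.
rewrite lnXn // ltr_pdivrMr ?exprn_gt0 // expr2 mulrA mulfVK ?lt0r_neq0 //.
by rewrite -[ln r *+ 4]mulr_natl ltr_pM2l // ln_sublinear.
Unshelve. all: by end_near.
Qed.

Lemma bounded_over_scale (u : nat -> R) (B : R) : (forall n, `|u n| <= B) ->
  ((fun n => u n / HL_scale n) @ \oo --> (0 : R))%classic.
Proof.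
move=> u_le; apply: norm_cvg0.
have B_cvg : ((fun n => B * (HL_scale n)^-1) @ \oo --> (0 : R))%classic.
  by rewrite -(mulr0 B); apply: cvgM; [exact: cvg_cst | exact: HL_scaleV_cvg0].
apply: (squeeze_cvgr _ (cvg_cst (0 : R)) B_cvg).
near=> n; have n_gt1 : (1 < n)%N by near: n; exists 2%N.
rewrite normr_ge0 /= normrM [X in _ * X]gtr0_norm ?invr_gt0 ?HL_scale_gt0 //.
by rewrite ler_pM2r ?invr_gt0 ?HL_scale_gt0.
Unshelve. all: by end_near.
Qed.

Lemma has_HL_density_eventually (A A' : pred nat) (B : nat) d :
    (forall p, (B <= p)%N -> A p = A' p) ->
  has_HL_density A d -> has_HL_density A' d.
Proof.
move=> eqA densA.
pose u n : R := (count_below A' n)%:R - (count_below A n)%:R.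
have u_le n : `|u n| <= B%:R.
  rewrite /u /count_below !natr_sum -sumrB (le_trans (ler_norm_sum _ _ _)) //.
  apply: le_trans (_ : \sum_(p < n) ((p < B)%N : nat)%:R <= _).
    apply: ler_sum => p _; case: ltnP => [_|/eqA->]; last by rewrite subrr normr0.
    by case: (A' p); case: (A p); rewrite ?subrr ?subr0 ?sub0r ?normrN ?normr1 ?normr0.
  rewrite -natr_sum ler_nat -(big_mkord xpredT (fun p => (p < B)%N : nat)).
  elim: n => [|n IHn]; first by rewrite big_geq.
  case: (ltnP n B) => nB; last by rewrite big_nat_recr //= ltnNge nB addn0.
  apply: leq_trans (_ : \sum_(0 <= p < n.+1) 1 <= _)%N.
    by apply: leq_sum => p _; case: (p < B)%N.
  by rewrite sum_nat_const_nat muln1 subn0.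
have := cvgD densA (bounded_over_scale u_le); rewrite addr0.
move=> lim; apply: (cvg_near_eq _ (lim _)); near=> n.
by rewrite /u /= -mulrDl addrC subrK.
Unshelve. all: by end_near.
Qed.

Lemma has_HL_density_diff (A A' : pred nat) a a' :
    (forall p, A' p -> A p) -> has_HL_density A a -> has_HL_density A' a' ->
  has_HL_density (fun p => A p && ~~ A' p) (a - a').
Proof.
move=> sub densA densA'; have := cvgB densA densA'.
move=> lim; apply: (cvg_near_eq _ (lim _)); near=> n.
transitivity ((count_below A n)%:R / HL_scale n - (count_below A' n)%:R / HL_scale n) => //.
rewrite -mulrBl; congr (_ / _); rewrite /count_below !natr_sum -sumrB.
apply: eq_bigr => p _; have := sub p.
by case: (A p); case: (A' p) => // h; rewrite ?subrr ?subr0 //; have := h isT.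
Unshelve. all: by end_near.
Qed.

Lemma has_HL_density0 : has_HL_density pred0 0.
Proof.
apply: (@bounded_over_scale _ 0) => n.
by rewrite /count_below big1 // normr0.
Qed.

Lemma has_HL_density_ratio (A A' : pred nat) c d : c != 0 ->
    has_HL_density A (d * c) -> has_HL_density A' c ->
  ((fun n => (count_below A n.+1)%:R / (count_below A' n.+1)%:R) @ \oo --> d)%classic.
Proof.
move=> c0 densA densA'.
rewrite (cvg_shiftS (fun n => (count_below A n)%:R / (count_below A' n)%:R : R)).
have lim : ((fun n => (count_below A n)%:R / HL_scale n
    * ((count_below A' n)%:R / HL_scale n)^-1) @ \oo --> (d : R))%classic.
  by rewrite -[d](mulfK c0); exact: cvgM densA (cvgV c0 densA').
apply: (cvg_near_eq _ lim); near=> n.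
have n_gt1 : (1 < n)%N by near: n; exists 2%N.
by rewrite (invf_div (count_below A' n)%:R) mulrA mulfVK // lt0r_neq0 ?HL_scale_gt0.
Unshelve. all: by end_near.
Qed.

End RelativeDensity.

(** * Primes of the form alpha^2 + 4 y^2 *)

(** Among the primes [alpha^2 + 4 y^2], those with [j] dividing [y]; as
    [split_primeE] shows, this does not depend on the choice of [y]. *)
Definition split_prime (alpha : int) (j : nat) : pred nat := fun p =>
  prime p && `[< exists y : nat, (j %| y)%N /\ p%:Z = alpha ^+ 2 + 4 * y%:Z ^+ 2 >].

Lemma split_primeE alpha j p y : prime p -> p%:Z = alpha ^+ 2 + 4 * y%:Z ^+ 2 ->
  split_prime alpha j p = (j %| y)%N.
Proof.
move=> p_pr def_p; rewrite /split_prime p_pr; apply/asboolP/idP; last by exists y.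
case=> y' [dvd_y']; rewrite def_p => /addrI /(mulfI (_ : 4 != 0 :> int)) - /(_ isT) /eqP.
by rewrite eqf_sqr => /orP[] /eqP def_y; have -> : y = y' by move: def_y; clear; lia.
Qed.

Lemma legendre_sqr_mul (k : nat) (d : int) (p : nat) : (k%:R : 'F_p) != 0 ->
  legendre (k%:Z ^+ 2 * d) p = legendre d p.
Proof.
move=> k0; have kE : (k%:Z)%:~R = k%:R :> 'F_p by [].
rewrite /legendre rmorphM rmorphXn /= kE mulf_eq0 expf_eq0 (negPf k0) /=.
case: ifP => // _; congr (if _ then _ else _).
apply/existsP/existsP => -[x /eqP def_x].
  by exists (x / k%:R); rewrite expr_div_n def_x mulrAC divff ?mul1r // expf_neq0.
by exists (k%:R * x); rewrite exprMn def_x.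
Qed.

Section HardyLittlewood.

Variables (R : realType) (HL : Hardy_Littlewood_conjecture R) (alpha : int).
Hypothesis alpha_odd : ~~ (2 %| alpha)%Z.

Let a i : int := 4 * (2 ^ i)%N%:Z ^+ 2.

Let absz_a i : `|a i|%N = (2 ^ (2 + i * 2))%N.
Proof. by rewrite /a abszM abszX absz_nat expnD expnM. Qed.

(** The discriminants [- 16 (2^i)^2 alpha^2] differ by squares and no odd prime
    divides the leading coefficients, so the infinite products are equal term by
    term, whether or not they converge; only the factor [2 / sqrt (a i)]
    changes. *)
Lemma HL_constant_pow2 i :
  HL_constant R (a i) 0 (alpha ^+ 2) = (2 ^ i)%N%:R^-1 * HL_constant R (a 0) 0 (alpha ^+ 2).
Proof.
have odd_ndvd p j : prime p -> (2 < p)%N -> (p %| a j)%Z = false.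
  move=> p_pr p_gt2; rewrite dvdzE absz_a absz_nat Euclid_dvdX // dvdn_prime2 //.
  by rewrite gtn_eqF.
have shape j : HL_constant R (a j) 0 (alpha ^+ 2) = (2 ^ j)%N%:R^-1 *
    limn (fun n : nat => \prod_(0 <= p < n | prime p && (2 < p)%N)
        (1 - (legendre (- (16 * alpha ^+ 2)) p)%:~R / (p%:R - 1)) : R)%classic.
  rewrite /HL_constant big1_seq => [|p]; last first.
    rewrite mem_primes => /andP[/andP[_ p_gt2] /and3P[p_pr _ p_dvd]].
    by have := odd_ndvd p j p_pr p_gt2; rewrite dvdzE p_dvd.
  rewrite mulr1; congr (_ * _).
    have -> : gcdz 2 (a j + 0) = 2.
      rewrite addr0 /gcdz absz_a; congr Posz.
      by apply/gcdn_idPl; rewrite expnD dvdn_mulr.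
    have -> : a j = (2 * 2 ^ j)%N%:Z ^+ 2 by rewrite /a PoszM; ring.
    rewrite rmorphXn /= -[((2 * 2 ^ j)%N%:Z)%:~R]/((2 * 2 ^ j)%N%:R).
    by rewrite sqrtr_sqr ger0_norm ?ler0n // natrM invfM mulrA divff ?mul1r.
  congr (limn _); apply/funext => n; apply: eq_big => [p|p /and3P[p_pr _ p_gt2]].
    by case p_pr: (prime p) => //=; case p_gt2: (2 < p)%N; rewrite ?andbF // odd_ndvd.
  congr (1 - _ %:~R / _).
  have -> : 0 ^+ 2 - 4 * a j * alpha ^+ 2 = (2 ^ j)%N%:Z ^+ 2 * - (16 * alpha ^+ 2).
    by rewrite /a; ring.
  apply: legendre_sqr_mul; rewrite Fp_nat_eq0 // Euclid_dvdX // dvdn_prime2 //.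
  by rewrite gtn_eqF.
by rewrite !shape expn0 invr1 mul1r.
Qed.

(** The conjecture applied to the polynomial [4 (2^i)^2 x^2 + alpha^2], whose
    prime values are the primes [alpha^2 + 4 y^2] with [y = 2^i x]. *)
Lemma HL_pow2 i :
  ((fun n : nat => (count_below (split_prime alpha (2 ^ i)) n)%:R
     / (HL_constant R (a i) 0 (alpha ^+ 2) * HL_scale R n)) @ \oo --> (1 : R))%classic.
Proof.
have alpha0 : alpha != 0 by apply: contraNneq alpha_odd => ->.
have a_gt0 : 0 < a i by rewrite mulr_gt0 // exprn_gt0 // ltz_nat expn_gt0.
have -> : (fun n => (count_below (split_prime alpha (2 ^ i)) n)%:R
     / (HL_constant R (a i) 0 (alpha ^+ 2) * HL_scale R n)) =
    (fun n => #|quadratic_primes (a i) 0 (alpha ^+ 2) n|%:R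
     / (HL_constant R (a i) 0 (alpha ^+ 2) * HL_scale R n)).
  apply/funext => n; congr (_%:R / _); rewrite -card_count_below; apply: eq_card => p.
  rewrite !inE /split_prime; congr (_ && _); apply/asboolP/asboolP.
    case=> y [/dvdnP[x ->] ->]; exists x; rewrite /a PoszM; ring.
  case=> x ->; exists (x * 2 ^ i)%N; split; first exact: dvdn_mull.
  by rewrite /a PoszM; ring.
apply: HL => //.
- apply/eqP; rewrite -[_ == 1]/(coprimez _ _) coprimezE.
  have -> : `|gcdz (a i) 0|%N = (2 ^ (2 + i * 2))%N by rewrite gcdz0 abszE absz_a.
  by rewrite abszX coprimeXl // coprimeXr // coprime2n; move: alpha_odd; clear; lia.
- case=> _; rewrite dvdzE abszX Euclid_dvdX // andbT -[(_ %| _)%N]/(2 %| alpha)%Z.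
  exact/negP.
move=> k; apply/eqP; rewrite lt_eqF // (lt_le_trans _ (sqr_ge0 k)) //.
by rewrite expr0n /= sub0r oppr_lt0 pmulr_rgt0 ?exprn_even_gt0 // mulr_gt0.
Qed.

Lemma HL_split_prime : exists2 c : R, c != 0 &
  forall i, has_HL_density (split_prime alpha (2 ^ i)) ((2 ^ i)%N%:R^-1 * c).
Proof.
(* Division by 0 is 0, so a vanishing constant would contradict [HL_pow2]. *)
have C0 : HL_constant R (a 0) 0 (alpha ^+ 2) != 0.
  apply/eqP => C0; have lim1 := HL_pow2 0.
  have lim0 : ((fun=> 0 : R) @ \oo --> (1 : R))%classic.
    apply: (cvg_near_eq _ lim1); apply: nearW => n.
    by rewrite C0 mul0r invr0 mulr0.
  have /eqP : (0 : R) = 1 by exact: (cvg_unique _ (cvg_cst (0 : R)) lim0).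
  by rewrite eq_sym oner_eq0.
exists (HL_constant R (a 0) 0 (alpha ^+ 2)) => // i; rewrite -HL_constant_pow2.
have Ci0 : HL_constant R (a i) 0 (alpha ^+ 2) != 0.
  by rewrite HL_constant_pow2 mulf_neq0 // invr_eq0 pnatr_eq0 expn_eq0.
set C := HL_constant _ _ _ _ in Ci0 *.
have lim : ((fun n => C * ((count_below (split_prime alpha (2 ^ i)) n)%:R
    / (C * HL_scale R n))) @ \oo --> (C : R))%classic.
  suff : ((fun n => C * ((count_below (split_prime alpha (2 ^ i)) n)%:R
    / (C * HL_scale R n))) @ \oo --> (C * 1 : R))%classic by rewrite mulr1.
  exact: cvgM (cvg_cst C) (HL_pow2 i).
apply: (cvg_near_eq _ lim); apply: nearW => n /=.
by rewrite invfM mulrCA mulVKf.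
Qed.

End HardyLittlewood.

Section Density.

Variables (R : realType) (alpha D : int).
Hypothesis alpha1 : (alpha = 1 %[mod 4])%Z.
Hypothesis D0 : D != 0.

(** It suffices to find a set [A] of primes of known density that agrees with
    the trace condition at every prime [alpha^2 + 4 y^2]: apart from 2 and
    the divisors of [2 D], which are finite in number, such primes are all that
    is counted. *)
Lemma dens_of_trace_predicate (m : int) (A : pred nat) (P : pred nat) (c d : R) :
    m ^+ 2 = alpha ^+ 2 -> c != 0 ->
    has_HL_density (split_prime alpha 1) c -> has_HL_density A (d * c) ->
    (forall p, A p -> split_prime alpha 1 p) ->
    (forall p y, prime p -> p%:Z = alpha ^+ 2 + 4 * y%:Z ^+ 2 -> A p = P y) ->
    (forall p y, prime p -> p%:Z = alpha ^+ 2 + 4 * y%:Z ^+ 2 ->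
       (a_p D p == 2 * m) = P y) ->
  dens_is D m d.
Proof.
move=> m2 c0 densS densA subA A_P a_P.
pose Q (p : nat) := prime p && `[< exists x : int, p%:Z = m ^+ 2 + x ^+ 2 >].
pose T (p : nat) := [&& Q p, ~~ (p %| 2 * D)%Z & a_p D p == 2 * m].
have eqQ p : (3 <= p)%N -> split_prime alpha 1 p = Q p.
  move=> p_gt2; rewrite /split_prime /Q; case p_pr: (prime p) => //=.
  rewrite m2; apply/asboolP/asboolP => -[].
    by move=> y [_ ->]; exists (2 * y%:Z); ring.
  move=> x def_p; have p_odd : odd p by apply: contraLR p_gt2 => /(prime_oddPn p_pr)->.
  have x_even : (2 %| x)%Z.
    apply/negPn/negP => /odd_int_rep [v def_x]; have [k def_a] := eq1_mod4_rep alpha1.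
    have : p%:Z = 2 * (1 + 4 * k + 8 * k ^+ 2 + 2 * v ^+ 2 + 2 * v).
      by rewrite def_p def_x def_a; ring.
    by move: (_ + _ + _) p_odd => t; clear; lia.
  have /dvdzP[y def_x] := x_even; exists `|y|%N; split=> //.
  by rewrite def_p def_x abszE -[X in 4 * X]normrX ger0_norm ?sqr_ge0 //; ring.
have densQ : has_HL_density Q c by exact: has_HL_density_eventually eqQ densS.
have densT : has_HL_density T (d * c).
  apply: (@has_HL_density_eventually _ A T (maxn 3 `|2 * D|.+1)) densA => p.
  rewrite geq_max => /andP[p_gt2 p_gtD]; rewrite /T -eqQ //.
  case S_p: (split_prime alpha 1 p); last by apply: contraFF (subA p) S_p.
  have /andP[p_pr /asboolP[y [_ def_p]]] := S_p.
  have -> : ~~ (p %| 2 * D)%Z.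
    by rewrite dvdzE gtnNdvd // absz_gt0 mulf_neq0.
  by rewrite (A_P _ _ p_pr def_p) (a_P _ _ p_pr def_p).
rewrite /dens_is; have -> : (fun N : nat => #|Qset_trace D m N|%:R / #|Qset m N|%:R : R)
    = (fun N => (count_below T N.+1)%:R / (count_below Q N.+1)%:R).
  apply/funext => N; rewrite -!card_count_below.
  by congr (_%:R / _%:R); apply: eq_card => p; rewrite !inE // /T andbA.
exact: has_HL_density_ratio c0 densT densQ.
Qed.

End Density.

Lemma split_prime_dvd alpha j p : split_prime alpha j p -> split_prime alpha 1 p.
Proof.
by case/andP=> p_pr /asboolP[y [_ def_p]]; rewrite (split_primeE _ p_pr def_p).
Qed.

Lemma split_prime4_2 alpha p : split_prime alpha 4 p -> split_prime alpha 2 p.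
Proof.
case/andP=> p_pr /asboolP[y [dvd_y def_p]]; rewrite (split_primeE _ p_pr def_p).
exact: dvdn_trans dvd_y.
Qed.

Section TraceDensity.

Variables (R : realType) (HL : Hardy_Littlewood_conjecture R) (alpha D : int).
Variables (neg : bool) (sigma : nat) (ps qs ls : seq nat) (b : nat).
Hypotheses (alpha1 : (alpha = 1 %[mod 4])%Z).
Hypothesis hD : D_factorization D neg sigma ps qs ls.
Hypothesis hdvd : forall p : nat, prime p -> odd p -> (p %| D)%Z -> (p %| alpha)%Z.
Let M := star_prod ps * star_prod qs ^+ 2 * star_prod ls ^+ 3.
Hypothesis def_D : D = (-1) ^+ b * 2 ^+ sigma * M.
Let e := (count_3_5 ps + count_3_5 ls)%N.

Let alpha_odd := eq1_mod4_odd alpha1.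

Let D0 : D != 0.
Proof.
case: hD => _ _; rewrite !all_cat => /and3P[h1 h2 h3] ->.
have prod_gt0 s : all (fun p => prime p && odd p) s -> (0 < \prod_(p <- s) p)%N.
  move=> /allP pr_s; rewrite big_seq prodn_cond_gt0 // => p /pr_s /andP[p_pr _].
  exact: prime_gt0.
by rewrite mulf_neq0 ?signr_eq0 // -lt0n !muln_gt0 !expn_gt0 !prod_gt0.
Qed.

Let alpha0 : 2 * alpha != 0.
Proof. by rewrite mulf_neq0 //; apply: contraNneq alpha_odd => ->. Qed.

Let sign_sqr (f : bool) : ((-1) ^+ f * alpha) ^+ 2 = alpha ^+ 2.
Proof. by rewrite exprMn sqrr_sign mul1r. Qed.

(** The sign [f] selects [alpha] or [- alpha]. *)
Let trace_eq_sign (E : nat) (f : bool) :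
  (2 * alpha * (-1) ^+ E == 2 * ((-1) ^+ f * alpha)) = (odd E == f).
Proof.
rewrite [_ ^+ f * _]mulrC mulrA (inj_eq (mulfI alpha0)) signr_eq //.
by case: f.
Qed.

(** The trace is [2 alpha (-1)^e] for every [y], so all the primes count or
    none does. *)
Lemma dens_constant (f : bool) h : sigma = (2 * h)%N -> ~~ odd (b + h) ->
  dens_is D ((-1) ^+ f * alpha) ((odd e == f)%:R : R).
Proof.
move=> def_sigma bh_even; have [c c0 dens_c] := HL_split_prime HL alpha_odd.
have dens1 := dens_c 0%N; rewrite expn0 invr1 mul1r in dens1.
have a_pE p y : prime p -> p%:Z = alpha ^+ 2 + 4 * y%:Z ^+ 2 ->
    (a_p D p == 2 * ((-1) ^+ f * alpha)) = (odd e == f).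
  move=> p_pr def_p.
  rewrite (a_p_sigma_even p_pr alpha1 def_p hD hdvd def_D def_sigma) trace_eq_sign.
  by rewrite oddD oddM (negPf bh_even) andbF addbF.
case: (odd e == f) a_pE => a_pE.
  apply: (dens_of_trace_predicate (A := split_prime alpha 1) (P := xpredT)
    alpha1 D0 (sign_sqr f) c0) => //; first by rewrite mul1r.
  by move=> p y p_pr def_p; rewrite (split_primeE _ p_pr def_p) dvd1n.
apply: (dens_of_trace_predicate (A := pred0) (P := pred0)
    alpha1 D0 (sign_sqr f) c0) => //.
by rewrite mul0r; exact: has_HL_density0.
Qed.

(** The sign of the trace is [(-1)^(e + y)], so the parity of [y] decides. *)
Lemma dens_half (f : bool) h : sigma = (2 * h)%N -> odd (b + h) ->
  dens_is D ((-1) ^+ f * alpha) (2^-1 : R).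
Proof.
move=> def_sigma bh_odd; have [c c0 dens_c] := HL_split_prime HL alpha_odd.
have dens1 := dens_c 0%N; rewrite expn0 invr1 mul1r in dens1.
have dens2 := dens_c 1%N; rewrite expn1 in dens2.
have a_pE p y : prime p -> p%:Z = alpha ^+ 2 + 4 * y%:Z ^+ 2 ->
    (a_p D p == 2 * ((-1) ^+ f * alpha)) = (odd e (+) odd y == f).
  move=> p_pr def_p.
  rewrite (a_p_sigma_even p_pr alpha1 def_p hD hdvd def_D def_sigma) trace_eq_sign.
  by rewrite oddD oddM bh_odd andbT.
case e_f: (odd e == f).
  apply: (dens_of_trace_predicate (A := split_prime alpha 2) (P := fun y => (2 %| y)%N)
    alpha1 D0 (sign_sqr f) c0 dens1 dens2) => // [p|p y p_pr def_p|p y p_pr def_p].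
  - exact: split_prime_dvd.
  - exact: split_primeE.
  by rewrite (a_pE _ _ p_pr def_p) dvdn2 -(eqP e_f); case: (odd e); case: (odd y).
apply: (dens_of_trace_predicate (P := fun y => odd y)
  (A := fun p => split_prime alpha 1 p && ~~ split_prime alpha 2 p)
    alpha1 D0 (sign_sqr f) c0 dens1) => // [|p|p y p_pr def_p|p y p_pr def_p].
- have -> : 2^-1 * c = c - 2%:R^-1 * c by field.
  by apply: has_HL_density_diff => // p; exact: split_prime_dvd.
- by case/andP.
- by rewrite !(split_primeE _ p_pr def_p) dvd1n dvdn2 negbK.
by rewrite (a_pE _ _ p_pr def_p) {a_pE}; move: (odd e) f e_f => [] []; case: (odd y).
Qed.

(** Odd [y] never counts, and for even [y] the sign of the trace is
    [(-1)^(e + y/2)], so the primes that count are those with [y] equal to 0, or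
    those with [y] equal to 2, modulo 4. *)
Lemma dens_quarter (f : bool) : odd sigma ->
  dens_is D ((-1) ^+ f * alpha) (4^-1 : R).
Proof.
move=> sigma_odd; have [c c0 dens_c] := HL_split_prime HL alpha_odd.
have dens1 := dens_c 0%N; rewrite expn0 invr1 mul1r in dens1.
have dens2 := dens_c 1%N; rewrite expn1 in dens2.
have dens4 := dens_c 2%N; rewrite -[(2 ^ 2)%N]/4%N in dens4.
have a_pE p y : prime p -> p%:Z = alpha ^+ 2 + 4 * y%:Z ^+ 2 ->
    (a_p D p == 2 * ((-1) ^+ f * alpha)) = ~~ odd y && (odd e (+) odd y./2 == f).
  move=> p_pr def_p; case y_odd: (odd y) => /=.
    apply: contraNF (a_p_sigma_odd_y_odd p_pr alpha1 def_p hD hdvd def_D sigma_odd y_odd).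
    by move=> /eqP->; rewrite exprMn sign_sqr exprMn.
  have def_y : y = (2 * y./2)%N by rewrite mul2n -[LHS]odd_double_half y_odd.
  rewrite (a_p_sigma_odd_y_even p_pr alpha1 def_p hD hdvd def_D sigma_odd def_y).
  by rewrite trace_eq_sign oddD.
case e_f: (odd e == f).
  apply: (dens_of_trace_predicate (A := split_prime alpha 4) (P := fun y => (4 %| y)%N)
    alpha1 D0 (sign_sqr f) c0 dens1 dens4) => // [p|p y p_pr def_p|p y p_pr def_p].
  - exact: split_prime_dvd.
  - exact: split_primeE.
  by rewrite (a_pE _ _ p_pr def_p) -(eqP e_f); move: (odd e); clear; case; lia.
apply: (dens_of_trace_predicate (P := fun y => (2 %| y)%N && ~~ (4 %| y)%N)
  (A := fun p => split_prime alpha 2 p && ~~ split_prime alpha 4 p)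
    alpha1 D0 (sign_sqr f) c0 dens1) => // [|p|p y p_pr def_p|p y p_pr def_p].
- have -> : 4^-1 * c = 2%:R^-1 * c - 4%:R^-1 * c by field.
  by apply: has_HL_density_diff => // p; exact: split_prime4_2.
- by case/andP=> /split_prime_dvd.
- by rewrite !(split_primeE _ p_pr def_p).
by rewrite (a_pE _ _ p_pr def_p) {a_pE}; move: (odd e) f e_f; clear; case; case => //= _; lia.
Qed.

End TraceDensity.

(** Since [M] is 1 modulo 4, the residue of the odd part of [D] modulo 4 is the
    sign [(-1)^b]. *)
Lemma sigma_of_residue (D M : int) (b sigma : nat) :
    (sigma <= 3)%N -> (M = 1 %[mod 4])%Z -> D = (-1) ^+ b * 2 ^+ sigma * M ->
  [/\ (D = 1 %[mod 4])%Z -> sigma = 0%N /\ ~~ odd b,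
      (D = 3 %[mod 4])%Z -> sigma = 0%N /\ odd b,
      exactly_divides 2 2 D -> ((D %/ 4)%Z = 1 %[mod 4])%Z -> sigma = 2%N /\ ~~ odd b,
      exactly_divides 2 2 D -> ((D %/ 4)%Z = 3 %[mod 4])%Z -> sigma = 2%N /\ odd b &
      exactly_divides 2 1 D \/ exactly_divides 2 3 D -> odd sigma].
Proof.
move=> sigma_le /eq1_mod4_rep[t ->]; rewrite -signr_odd.
rewrite /exactly_divides -[(2 ^ 1)%N]/2%N -[(2 ^ 2)%N]/4%N -[(2 ^ 3)%N]/8%N.
rewrite -[(2 ^ 4)%N]/16%N.
have pow2 : (2 : int) ^+ 2 = 4 by [].
have pow3 : (2 : int) ^+ 3 = 8 by [].
have : sigma = 0%N \/ sigma = 1%N \/ sigma = 2%N \/ sigma = 3%N.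
  by move: sigma_le; clear; lia.
case: (odd b); rewrite ?expr0 ?expr1; case=> [->|[->|[->|->]]];
  rewrite ?expr0 ?expr1 ?pow2 ?pow3 ?mulN1r ?mul1r => ->; clear;
  split; first [by move=> *; split | move=> *; exfalso; lia | by move=> *].
Qed.

Theorem theorem3p12 (R : realType) (HL : Hardy_Littlewood_conjecture R)
    (alpha D : int) (neg : bool) (sigma : nat) (ps qs ls : seq nat)
    (halpha : (alpha = 1 %[mod 4])%Z)
    (hD : D_factorization D neg sigma ps qs ls)
    (hdvd : forall p : nat, prime p -> odd p -> (p %| D)%Z -> (p %| alpha)%Z) :
  let e := (count_mod8 3 ps + count_mod8 5 ps
            + count_mod8 3 ls + count_mod8 5 ls)%N in
  [/\ (D = 1 %[mod 4])%Z ->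
        dens_is D alpha (2^-1 * (1 + (-1) ^+ e) : R) /\
        dens_is D (- alpha) (2^-1 * (1 - (-1) ^+ e) : R),
      (D = 3 %[mod 4])%Z ->
        dens_is D alpha (2^-1 : R) /\ dens_is D (- alpha) (2^-1 : R),
      exactly_divides 2 2 D ->
        ((D %/ 4)%Z = 1 %[mod 4])%Z ->
          dens_is D alpha (2^-1 : R) /\ dens_is D (- alpha) (2^-1 : R),
      exactly_divides 2 2 D ->
        ((D %/ 4)%Z = 3 %[mod 4])%Z ->
          dens_is D alpha (2^-1 * (1 + (-1) ^+ e) : R) /\
          dens_is D (- alpha) (2^-1 * (1 - (-1) ^+ e) : R) &
      exactly_divides 2 1 D \/ exactly_divides 2 3 D ->
        dens_is D alpha (4^-1 : R) /\ dens_is D (- alpha) (4^-1 : R)].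
Proof.
have sigma_le3 : (sigma <= 3)%N by case: hD.
have [[b def_D] M1] := D_decomposition hD; move=> e.
set M := (X in _ * X) in def_D; rewrite -/M in M1.
have constant h : sigma = (2 * h)%N -> ~~ odd (b + h) ->
    dens_is D alpha (2^-1 * (1 + (-1) ^+ e) : R) /\
    dens_is D (- alpha) (2^-1 * (1 - (-1) ^+ e) : R).
  have -> : e = (count_3_5 ps + count_3_5 ls)%N by rewrite /e /count_3_5 !addnA.
  move=> def_sigma bh.
  have plus := dens_constant (f := false) HL halpha hD hdvd def_D def_sigma bh.
  have minus := dens_constant (f := true) HL halpha hD hdvd def_D def_sigma bh.
  rewrite expr0 expr1 mul1r mulN1r in plus minus.
  rewrite -[(-1) ^+ _]signr_odd; move: plus minus; case: (odd _) => /=.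
    by rewrite expr1 opprK subrr mulr0 mulVf.
  by rewrite expr0 subrr mulr0 mulVf.
have half h : sigma = (2 * h)%N -> odd (b + h) ->
    dens_is D alpha (2^-1 : R) /\ dens_is D (- alpha) (2^-1 : R).
  move=> def_sigma bh.
  have := dens_half HL halpha hD hdvd def_D true def_sigma bh.
  have := dens_half HL halpha hD hdvd def_D false def_sigma bh.
  by rewrite expr0 expr1 mul1r mulN1r.
have [D1 D3 D41 D43 D2] := sigma_of_residue sigma_le3 M1 def_D.
split.
- by move=> /D1[s0 b_even]; apply: (constant 0%N); rewrite ?addn0.
- by move=> /D3[s0 b_odd]; apply: (half 0%N); rewrite ?addn0.
- by move=> /D41/[apply] [[s2 b_even]]; apply: (half 1%N); rewrite ?addn1.
- by move=> /D43/[apply] [[s2 b_odd]]; apply: (constant 1%N); rewrite ?addn1 //= b_odd.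
move=> /D2 sigma_odd.
have := dens_quarter HL halpha hD hdvd def_D true sigma_odd.
have := dens_quarter HL halpha hD hdvd def_D false sigma_odd.
by rewrite expr0 expr1 mul1r mulN1r.
Qed.
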